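(* Let $\mathfrak M\models S_{\overline\alpha}$. The following are equivalent: (1) $\mathfrak M$ is atomic; (2) $d_{\mathfrak M}(\mathfrak A)=0$ for every finite $\mathfrak A\subseteq\mathfrak M$, and $\mathfrak M$ has finite closures; (3) $\mathfrak M$ is existentially closed (among models of $S_{\overline\alpha}$) and has finite closures; (4) for every finite $\mathfrak A\subseteq\mathfrak M$ there is a finite $\mathfrak B$ with $\mathfrak A\subseteq\mathfrak B\subseteq\mathfrak M$ and $\delta(\mathfrak B)=0$.
   Context: Fix a finite relational language $L$ in which every relation symbol has arity at least $2$. $K_L$ is the class of all finite $L$-structures (including the empty one) in which every relation symbol is interpreted symmetrically and irreflexively. Fix $\overline\alpha:L\to(0,1]$, writing $\overline\alpha_E=\overline\alpha(E)$, such that it is not the case that all symbols of $L$ are binary and $\overline\alpha_E=1$ for all $E$. For $\mathfrak A\in K_L$ let $N_E(\mathfrak A)$ be the number of subsets of $A$ on which $E$ holds and $\delta(\mathfrak A)=|A|-\sum_{E}\overline\alpha_E N_E(\mathfrak A)$. $K_{\overline\alpha}=\{\mathfrak A\in K_L:\delta(\mathfrak A')\ge0\text{ for all substructures }\mathfrak A'\subseteq\mathfrak A\}$. Subsets of a structure are identified with induced substructures. For $\mathfrak A\subseteq\mathfrak B$ in $K_L$, $\mathfrak A\le\mathfrak B$ means $\delta(\mathfrak A)\le\delta(\mathfrak A')$ for all $\mathfrak A\subseteq\mathfrak A'\subseteq\mathfrak B$; for an arbitrary structure $\mathfrak X$ all of whose finite substructures lie in $K_L$ and finite $\mathfrak A\subseteq\mathfrak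 X$, $\mathfrak A\le\mathfrak X$ means $\mathfrak A\le\mathfrak B$ for every finite $\mathfrak B$ with $\mathfrak A\subseteq\mathfrak B\subseteq\mathfrak X$. $S_{\overline\alpha}$ is the theory whose models $\mathfrak M$ are those in which every finite substructure lies in $K_{\overline\alpha}$ and, for all $\mathfrak A\le\mathfrak B$ in $K_{\overline\alpha}$, every embedding $\mathfrak A\to\mathfrak M$ extends to an embedding $\mathfrak B\to\mathfrak M$. $\mathfrak M$ has finite closures if every finite $\mathfrak A\subseteq\mathfrak M$ is contained in some finite $\mathfrak B\subseteq\mathfrak M$ with $\mathfrak B\le\mathfrak M$. For finite $\mathfrak A\subseteq\mathfrak M$, $d_{\mathfrak M}(\mathfrak A)=\inf\{\delta(\mathfrak B):\mathfrak A\subseteq\mathfrak B,\ \mathfrak B\text{ finite},\ \mathfrak B\le\mathfrak M\}$. *)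

(* Defs.v *)
From HB Require Import structures.
From mathcomp Require Import all_boot all_order all_algebra finmap.
From mathcomp Require Import boolp classical_sets reals constructive_ereal ereal.
Set Implicit Arguments. Unset Strict Implicit. Unset Printing Implicit Defensive.
Import Order.TTheory GRing.Theory Num.Theory.
Local Open Scope ring_scope.
Local Open Scope fset_scope.

Section Defs.
Variables (L : finType) (ar : L -> nat).

Record lstruct := LStruct {
  ldom :> choiceType;
  lrel : forall E : L, (ar E).-tuple ldom -> bool }.

Arguments lrel {l} E t.

(* A finite substructure (finite subset A, with induced relations) lies in K_L:
   every relation is symmetric and irreflexive on tuples from A. *)
Definition inKL (M : lstruct) (A : {fset M}) : Prop :=
  forall (E : L) (t t' : (ar E).-tuple A),
    (lrel E (map_tuple val t) -> uniq t) /\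
    (perm_eq t t' -> lrel E (map_tuple val t) = lrel E (map_tuple val t')).

Definition holds_on (M : lstruct) (A : {fset M}) (E : L) (S : {set A}) : bool :=
  [exists t : (ar E).-tuple A, lrel E (map_tuple val t) && (S == [set x in t])].

Definition NE (M : lstruct) (A : {fset M}) (E : L) : nat :=
  #|[set S : {set A} | holds_on E S]|.

Section Weights.
Variables (R : realType) (alpha : L -> R).

Definition delta (M : lstruct) (A : {fset M}) : R :=
  (#|` A|)%:R - \sum_(E : L) alpha E * (NE A E)%:R.

Definition inKalpha (M : lstruct) (A : {fset M}) : Prop :=
  inKL A /\ forall A' : {fset M}, A' `<=` A -> 0 <= delta A'.

Definition leS (M : lstruct) (A B : {fset M}) : Prop :=
  A `<=` B /\ forall A' : {fset M}, A `<=` A' -> A' `<=` B -> delta A <= delta A'.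

Definition leM (M : lstruct) (A : {fset M}) : Prop :=
  forall B : {fset M}, A `<=` B -> leS A B.

Definition emb_from (B M : lstruct) (A : {fset B}) (f : A -> M) : Prop :=
  injective f /\
  forall (E : L) (t : (ar E).-tuple A),
    lrel E (map_tuple val t) = lrel E (map_tuple f t).

Definition is_model (M : lstruct) : Prop :=
  (forall A : {fset M}, inKalpha A) /\
  forall (B : lstruct) (X Y : {fset B}),
    inKalpha Y -> leS X Y ->
    forall f : X -> M, emb_from f ->
    exists g : Y -> M, emb_from g /\
      forall (x : X) (y : Y), val x = val y -> g y = f x.

Definition fin_closures (M : lstruct) : Prop :=
  forall A : {fset M}, exists B : {fset M}, A `<=` B /\ leM B.

(* d_M(A) = inf { delta(B) : A subset B finite, B <= M }  (inf of empty set = +oo) *)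
Definition dM (M : lstruct) (A : {fset M}) : \bar R :=
  ereal_inf [set (delta B)%:E | B in [set B : {fset M} | A `<=` B /\ leM B]].

End Weights.

Inductive formula :=
  | F_eq : nat -> nat -> formula
  | F_rel : forall E : L, (ar E).-tuple nat -> formula
  | F_not : formula -> formula
  | F_and : formula -> formula -> formula
  | F_ex : nat -> formula -> formula.

Definition upd (M : Type) (v : nat -> M) (x : nat) (a : M) : nat -> M :=
  fun y => if y == x then a else v y.

Fixpoint sat (M : lstruct) (v : nat -> M) (phi : formula) : Prop :=
  match phi with
  | F_eq x y => v x = v y
  | F_rel E t => lrel E (map_tuple v t)
  | F_not p => ~ sat v p
  | F_and p q => sat v p /\ sat v q
  | F_ex x p => exists a : M, sat (upd v x a) p
  end.

Fixpoint free (x : nat) (phi : formula) : bool :=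
  match phi with
  | F_eq y z => (x == y) || (x == z)
  | F_rel E t => x \in (t : seq nat)
  | F_not p => free x p
  | F_and p q => free x p || free x q
  | F_ex y p => (x != y) && free x p
  end.

Definition fv_below (n : nat) (phi : formula) : Prop :=
  forall x, free x phi -> (x < n)%N.

Fixpoint qfree (phi : formula) : bool :=
  match phi with
  | F_eq _ _ | F_rel _ _ => true
  | F_not p => qfree p
  | F_and p q => qfree p && qfree q
  | F_ex _ _ => false
  end.

Definition exs (ys : seq nat) (phi : formula) : formula := foldr F_ex phi ys.

(* M is atomic: every finite tuple (the values v 0, ..., v (n-1) of an
   assignment) realizes a type isolated in Th(M): some phi(x_0..x_{n-1})
   true of it such that M |= forall x, phi -> psi for every psi in its type. *)
Definition atomic (M : lstruct) : Prop :=
  forall (n : nat) (v : nat -> M), exists phi : formula,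
    fv_below n phi /\ sat v phi /\
    forall psi : formula, fv_below n psi -> sat v psi ->
      forall w : nat -> M, sat w phi -> sat w psi.

Definition embedding (M N : lstruct) (h : M -> N) : Prop :=
  injective h /\
  forall (E : L) (t : (ar E).-tuple M), lrel E t = lrel E (map_tuple h t).

End Defs.

Arguments lrel {L ar l} E t.

Definition ex_closed (L : finType) (ar : L -> nat) (R : realType) (alpha : L -> R)
  (M : lstruct ar) : Prop :=
  forall (N : lstruct ar) (h : M -> N), is_model alpha N -> embedding h ->
  forall (ys : seq nat) (phi : formula ar), qfree phi ->
  forall v : nat -> M, sat (h \o v) (exs ys phi) -> sat v (exs ys phi).

(* Main.v *)
(* Condition (4) gives the others directly: a set of predimension 0 is closed in
   every structure whose finite substructures have nonnegative predimension, so
   its isomorphism type determines its type.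

   Conversely everything rests on one construction: over C0 <= C there is
   an extension Y of C with C0 <= Y, with no small subextension of C in Y of negative
   relative predimension, and with the predimension of Y over C0 arbitrarily small.
   Such a Y is obtained by attaching to C many copies of a chain of new vertices
   of total relative predimension -eta.  A partial chain has value U in [0, 1]; a
   symbol of weight a either becomes a further hyperedge at the last vertex
   (U := U - a) or, when a > U, links it to a new vertex (U := U - a + 1).  So the
   value performs a rotation of the circle, and eta is made small, or the
   generator of the group of values when the weights are rational, by
   stopping at a suitable moment.

   Call X k-closed if no extension of X by at most k points has smaller
   predimension.  In a model of S_alpha the construction yields, over a k1-closed set
   with k1 large, k-closed copies of strong extensions, and a back-and-forth
   argument shows that each formula is decided by the isomorphism type of a k-closed
   set containing its parameters.  If A lies in no set of predimension 0, a k-closed K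
   containing A has two k-closed copies, only one of which has a certain larger
   extension of smaller predimension, so no formula isolates the type of A.
   Likewise a closed B of positive predimension stops being closed in a
   suitable extension of the model, which contradicts existential closedness. *)
Require Import Defs.
From HB Require Import structures.
From mathcomp Require Import all_boot all_order all_algebra finmap.
From mathcomp Require Import boolp classical_sets reals constructive_ereal ereal.
From mathcomp Require Import ring lra zify.
Import Order.TTheory GRing.Theory Num.Theory.
Local Open Scope ring_scope.
Local Open Scope fset_scope.
Local Open Scope ring_scope.
Set Implicit Arguments. Unset Strict Implicit. Unset Printing Implicit Defensive.

(** * Predimension of a hypergraph *)

Lemma eq_cardfs (T : choiceType) (A B : {fset T}) : A = B -> #|` A| = #|` B|.
Proof. by move->. Qed.

Lemma leq_card_image (T T' : choiceType) (f : T -> T') (A : {fset T}) :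
  (#|` f @` A| <= #|` A|)%N.
Proof. exact: leq_imfset_card. Qed.

Section Predim.
Variables (R : realType) (L : finType) (alpha : L -> R).
Hypothesis halpha : forall E, 0 < alpha E <= 1.

Lemma alpha_ge0 E : 0 <= alpha E.
Proof. by case/andP: (halpha E) => /ltW. Qed.

Implicit Type T : choiceType.

Definition cnt T (e : L -> {fset T} -> bool) E (X : {fset T}) : nat :=
  #|` [fset S in fpowerset X | e E S]|.

(** The predimension is defined for a bare hypergraph, one family of finite sets per symbol, so that
    hyperedges can be added one at a time before any structure is built. *)
Definition dl T (e : L -> {fset T} -> bool) (X : {fset T}) : R :=
  (#|` X|)%:R - \sum_(E : L) alpha E * (cnt e E X)%:R.

Lemma cnt_supermod T (e : L -> {fset T} -> bool) E (X Y : {fset T}) :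
  (cnt e E X + cnt e E Y <= cnt e E (X `|` Y) + cnt e E (X `&` Y))%N.
Proof.
rewrite /cnt -cardfsUI; apply: leq_add; last first.
  rewrite fsubset_leq_card //; apply/fsubsetP => S.
  by rewrite !inE /= !fpowersetE fsubsetI => /andP[/andP[-> ->] /andP[-> _]].
rewrite fsubset_leq_card //; apply/fsubsetP => S.
rewrite !inE /= !fpowersetE => /orP[]/andP[SX ->]; rewrite andbT.
  exact: fsubset_trans SX (fsubsetUl _ _).
exact: fsubset_trans SX (fsubsetUr _ _).
Qed.

(** Submodularity: a hyperedge inside [X] or [Y] lies in the union, and one inside both lies in the
    intersection. The closedness arguments below rest on this inequality. *)
Lemma dlUI T (e : L -> {fset T} -> bool) (X Y : {fset T}) :
  dl e (X `|` Y) + dl e (X `&` Y) <= dl e X + dl e Y.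
Proof.
rewrite /dl addrACA [leRHS]addrACA -!opprD -!natrD cardfsUI lerD2l lerN2.
rewrite -!big_split /=; apply: ler_sum => E _; rewrite -!mulrDr -!natrD.
by rewrite ler_wpM2l ?alpha_ge0 // ler_nat cnt_supermod.
Qed.

(** The case of equality, for free amalgams: no hyperedge meets both differences. *)
Lemma dl_free T (e : L -> {fset T} -> bool) (X Y : {fset T}) :
  (forall E S, e E S -> S `<=` X `|` Y -> (S `<=` X) || (S `<=` Y)) ->
  dl e (X `|` Y) + dl e (X `&` Y) = dl e X + dl e Y.
Proof.
move=> free; rewrite /dl addrACA [RHS]addrACA -!opprD -!natrD cardfsUI.
congr (_ - _); rewrite -!big_split /=; apply: eq_bigr => E _.
rewrite -!mulrDr -!natrD; congr (_ * _%:R); rewrite /cnt -[RHS]cardfsUI.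
congr addn; apply: eq_cardfs; apply/fsetP => S.
  rewrite !inE /= !fpowersetE; apply/idP/idP => [/andP[SXY eS]|].
    by rewrite eS !andbT; apply: free eS SXY.
  by move=> /orP[]/andP[SX ->]; rewrite andbT (fsubset_trans SX) ?fsubsetUl ?fsubsetUr.
by rewrite !inE /= !fpowersetE fsubsetI; case: (e E S); rewrite ?andbT ?andbF.
Qed.

Lemma dl_transport (T T' : choiceType) (e : L -> {fset T} -> bool)
    (e' : L -> {fset T'} -> bool) (h : T -> T') (X : {fset T}) :
  {in X &, injective h} ->
  (forall E S, S `<=` X -> e' E (h @` S) = e E S) ->
  dl e' (h @` X) = dl e X.
Proof.
move=> injh he; rewrite /dl card_in_imfset //=; congr (_ - _).
apply: eq_bigr => E _; congr (_ * _%:R).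
rewrite /cnt; set F := [fset S in fpowerset X | e E S].
transitivity (#|` (fun S : {fset T} => h @` S) @` F|).
  apply: eq_cardfs; apply/fsetP => S'; rewrite !inE /= fpowersetE.
  apply/idP/imfsetP => /= [/andP[S'X eS']|[S]]; last first.
    rewrite !inE /= fpowersetE => /andP[SX eS] ->; rewrite he // eS andbT.
    by apply/fsubsetP => _ /imfsetP[x /= xS ->]; apply/imfsetP; exists x => //=; apply: (fsubsetP SX).
  pose S := [fset x in X | h x \in S'].
  have SX : S `<=` X by apply/fsubsetP => x; rewrite !inE => /andP[].
  have ES : S' = h @` S.
    apply/fsetP => y; apply/idP/imfsetP => /= [yS'|[x]]; last first.
      by rewrite !inE => /andP[_ +] ->.
    have /imfsetP[x /= xX yE] := fsubsetP S'X _ yS'.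
    by exists x => //; rewrite !inE xX -yE.
  by exists S => //; rewrite !inE /= fpowersetE SX -he // -ES.
rewrite card_in_imfset //= => S1 S2; rewrite !inE /= !fpowersetE => /andP[S1X _] /andP[S2X _] E12.
have sub A B : A `<=` X -> B `<=` X -> h @` A = h @` B -> A `<=` B.
  move=> AX BX EAB; apply/fsubsetP => x xA.
  have : h x \in h @` B by rewrite -EAB; apply/imfsetP; exists x.
  move=> /imfsetP[y /= yB xy]; rewrite (injh x y) //.
    exact: (fsubsetP AX).
  exact: (fsubsetP BX).
by apply/eqP; rewrite eqEfsubset; apply/andP; split; apply: sub.
Qed.

Lemma eq_dl T (e e' : L -> {fset T} -> bool) (X : {fset T}) :
  (forall E S, S `<=` X -> e' E S = e E S) -> dl e' X = dl e X.
Proof.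
move=> ee'; rewrite /dl; congr (_ - _); apply: eq_bigr => E _.
congr (_ * _%:R); apply: eq_cardfs; apply/fsetP => S; rewrite !inE /= fpowersetE.
by case SX: (S `<=` X) => //=; apply: ee'.
Qed.

Lemma dl0 T (e : L -> {fset T} -> bool) :
  (forall E, e E fset0 = false) -> dl e fset0 = 0.
Proof.
move=> e0; rewrite /dl cardfs0 big1 ?subrr // => E _.
suff -> : cnt e E fset0 = 0%N by rewrite mulr0.
apply/eqP; rewrite cardfs_eq0; apply/eqP/fsetP => S; rewrite !inE /= fpowersetE fsubset0.
by apply/negP => /andP[/eqP ->]; rewrite e0.
Qed.

Lemma dl_le_card T (e : L -> {fset T} -> bool) (X : {fset T}) :
  dl e X <= (#|` X|)%:R.
Proof. by rewrite lerBlDr lerDl sumr_ge0 // => E _; rewrite mulr_ge0 ?alpha_ge0. Qed.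

Lemma dl_isolated T (e : L -> {fset T} -> bool) (X : {fset T}) x :
  x \notin X -> (forall E S, e E S -> x \notin S) ->
  dl e (x |` X) = dl e X + 1.
Proof.
move=> xX ex; rewrite /dl cardfsU1 xX add1n -[X in X%:R]addn1 natrD.
rewrite addrAC; congr (_ - _ + _); apply: eq_bigr => E _.
congr (_ * _%:R); apply: eq_cardfs; apply/fsetP => S; rewrite !inE /= !fpowersetE.
case eS: (e E S); rewrite ?andbT ?andbF //.
apply/idP/idP => [SxX|SX]; last exact: fsubset_trans SX (fsubsetU1 _ _).
apply/fsubsetP => y yS; have := fsubsetP SxX _ yS; rewrite !inE => /orP[/eqP yx|//].
by have := ex _ _ eS; rewrite -yx yS.
Qed.

Definition add_edge T (e : L -> {fset T} -> bool) E0 S0 E S :=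
  e E S || (E == E0) && (S == S0).

Lemma dl_add_edge T (e : L -> {fset T} -> bool) E0 (S0 X : {fset T}) :
  ~~ e E0 S0 ->
  dl (add_edge e E0 S0) X = dl e X - (if S0 `<=` X then alpha E0 else 0).
Proof.
move=> eS0; rewrite /dl -addrA -opprD; congr (_ - _).
have -> : (if S0 `<=` X then alpha E0 else 0) =
    \sum_(E : L) alpha E * ((E == E0) && (S0 `<=` X))%:R.
  rewrite (bigD1 E0) //= eqxx big1 ?addr0; last by move=> E /negPf ->; rewrite mulr0.
  by case: ifP; rewrite ?mulr1 ?mulr0.
rewrite -big_split /=; apply: eq_bigr => E _; rewrite -mulrDr -natrD; congr (_ * _%:R).
rewrite /cnt; have [->|EE0] /= := eqVneq E E0; last first.
  rewrite addn0; apply: eq_cardfs; apply/fsetP => S.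
  by rewrite !inE /= /add_edge (negPf EE0) orbF.
have [S0X|S0X] := boolP (S0 `<=` X); last first.
  rewrite addn0; apply: eq_cardfs; apply/fsetP => S.
  rewrite !inE /= /add_edge eqxx /= fpowersetE.
  by case: eqVneq => [->|_]; rewrite ?orbF // (negPf S0X).
rewrite addn1 -[RHS]add1n.
rewrite (_ : [fset S in _ | _] = S0 |` [fset S in fpowerset X | e E0 S]).
  by rewrite cardfsU1 !inE /= (negPf eS0) andbF.
apply/fsetP => S; rewrite !inE /= /add_edge eqxx /= fpowersetE.
by case: eqVneq => [->|_]; rewrite ?orbF // S0X orbT.
Qed.

End Predim.

(** * Uniform gaps and k-closures *)

Section Gap.
Variables (R : realType) (L : finType) (alpha : L -> R).
Hypothesis halpha : forall E, 0 < alpha E <= 1.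
Local Notation dla := (dl alpha).

Lemma cnt_mono (T : choiceType) (e : L -> {fset T} -> bool) E (X Y : {fset T}) :
  X `<=` Y -> (cnt e E X <= cnt e E Y)%N.
Proof.
move=> XY; apply: fsubset_leq_card; apply/fsubsetP => S.
by rewrite !inE /= !fpowersetE => /andP[/fsubset_trans->].
Qed.

(** If some symbol gains at least [B] hyperedges, these weigh at least [k + 1], and the at most [k]
    new points leave a drop of at least 1. Otherwise only finitely many relative values occur, and
    [eps] is the minimum of 1 and the absolute values of the negative ones. *)
Lemma dl_gap k : exists2 eps : R, 0 < eps &
  forall (T : choiceType) (e : L -> {fset T} -> bool) (X Y : {fset T}),
    X `<=` Y -> (#|` Y `\` X| <= k)%N -> dla e Y < dla e X ->
    dla e Y <= dla e X - eps.
Proof.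
have [B hB] : exists B : nat, forall E, k.+1%:R <= alpha E * B%:R.
  exists (\max_E (Num.bound (k.+1%:R / alpha E))) => E.
  have aE : 0 < alpha E by case/andP: (halpha E).
  rewrite mulrC -ler_pdivrMr //; apply: le_trans (ltW (archi_boundP _)) _.
    by rewrite divr_ge0 // ltW.
  by rewrite ler_nat (leq_bigmax E).
pose val (z : 'I_k.+1 * {ffun L -> 'I_B}) : R :=
  (z.1 : nat)%:R - \sum_E alpha E * (z.2 E : nat)%:R.
exists (\big[Num.min/1]_(z | val z < 0) - val z).
  apply: (big_ind (fun x => 0 < x)) => // [x y x0 y0|z]; first by rewrite lt_min x0.
  by rewrite oppr_gt0.
move=> T e X Y XY cardYX ltYX.
have rel : dla e Y = dla e X +
    ((#|` Y `\` X|)%:R - \sum_E alpha E * (cnt e E Y - cnt e E X)%:R).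
  rewrite /dl (cardfsDS XY) natrB ?fsubset_leq_card // addrACA subrKC.
  rewrite -opprD -big_split /=; congr (_ - _); apply: eq_bigr => E _.
  by rewrite -mulrDr natrB ?cnt_mono // subrKC.
move: ltYX; rewrite rel gtrDl lerD2l.
set d := (#|` _|) in cardYX *; set m := fun E => (cnt e E Y - cnt e E X)%N => lt0.
have [/forallP mB|] := boolP [forall E, (m E < B)%N].
  pose z : 'I_k.+1 * {ffun L -> 'I_B} :=
    (Ordinal (cardYX : (d < k.+1)%N), [ffun E => Ordinal (mB E)]).
  have valz : val z = d%:R - \sum_E alpha E * (m E)%:R.
    by rewrite /val /=; congr (_ - _); apply: eq_bigr => E _; rewrite ffunE.
  by rewrite -valz lerNr; apply: bigmin_le_cond; rewrite valz.
rewrite negb_forall => /existsP[E]; rewrite -leqNgt => BE.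
apply: (@le_trans _ _ (-1)); last by rewrite lerN2; apply: bigmin_le_id.
have kd : d%:R <= k%:R :> R by rewrite ler_nat.
have : k.+1%:R <= \sum_E alpha E * (m E)%:R.
  rewrite (bigD1 E) //= (le_trans (hB E)) // ler_wpDr ?sumr_ge0 //.
    by move=> E' _; rewrite mulr_ge0 // alpha_ge0.
  by rewrite ler_wpM2l ?alpha_ge0 ?ler_nat.
rewrite -natr1; lra.
Qed.

Definition kclosed (T : choiceType) (e : L -> {fset T} -> bool) k (X : {fset T}) :=
  forall Y, X `<=` Y -> (#|` Y `\` X| <= k)%N -> dla e X <= dla e Y.

Lemma kclosed_le (T : choiceType) (e : L -> {fset T} -> bool) k k' (X : {fset T}) :
  (k' <= k)%N -> kclosed e k X -> kclosed e k' X.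
Proof. by move=> k'k clX Y XY cY; apply: clX => //; apply: leq_trans k'k. Qed.

(** While the set is not [k]-closed, adding at most [k] points lowers the predimension by at least
    the gap [eps]. It starts at most at [n] and stays nonnegative, so at most [J] rounds occur. *)
Lemma kclosure k n : exists s, forall (T : choiceType) (e : L -> {fset T} -> bool)
    (A : {fset T}), (forall X, 0 <= dla e X) -> (#|` A| <= n)%N ->
  exists C, [/\ A `<=` C, kclosed e k C & (#|` C| <= s)%N].
Proof.
have [eps eps0 gap] := dl_gap k.
pose J := Num.bound (n%:R / eps).
exists (n + J * k)%N => T e A ge0 cA.
suff step j : forall B, A `<=` B -> dla e B < j%:R * eps -> exists C, [/\ A `<=` C, kclosed e k C &
    (#|` C| <= #|` B| + j * k)%N].
  have [||C [AC clC cC]] := step J A; rewrite ?fsubset_refl //.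
    rewrite -ltr_pdivrMr //; apply: le_lt_trans (archi_boundP _); last first.
      by rewrite divr_ge0 // ltW.
    by rewrite ler_pM2r ?invr_gt0 // (le_trans (dl_le_card halpha _ _)) // ler_nat.
  by exists C; split=> //; rewrite (leq_trans cC) // leq_add2r.
elim: j => [|j IH] B AB ltB.
  by have := ge0 B; rewrite mul0r in ltB; rewrite leNgt ltB.
have [clB|/existsNP[Y /not_implyP[BY /not_implyP[cY /negP]]]] := pselect (kclosed e k B).
  by exists B; split=> //; rewrite leq_addr.
rewrite -ltNge => /(gap _ _ _ _ BY cY) leY.
have [||C [AC clC cC]] := IH Y; first exact: fsubset_trans AB BY.
  by move: ltB; rewrite -natr1 mulrDl mul1r; lra.
exists C; split=> //; apply: leq_trans cC _.
rewrite mulSn addnA leq_add2r -(cardfsID B Y).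
by rewrite leq_add // fsubset_leq_card // fsubsetIr.
Qed.

End Gap.

(** * Small values of integer combinations of the weights *)

(** Dirichlet's pigeonhole argument: among [N + 1] multiples of [a], two have fractional parts in
    the same cell of width [1/N]. Only the sign of their difference then needs repair. *)
Lemma small_multiple (R : realType) (a : R) : 0 < a ->
  (exists q n : nat, (0 < q)%N /\ q%:R * a = n%:R) \/
  (forall eps, 0 < eps -> exists q n : nat, 0 < q%:R * a - n%:R < eps).
Proof.
move=> a0.
have [rat|irr] := pselect (exists q n : nat, (0 < q)%N /\ q%:R * a = n%:R); [by left|right].
move=> eps eps0; pose N := (Num.truncn eps^-1).+1.
have N0 : 0 < N%:R :> R by rewrite ltr0n.
have Neps : N%:R^-1 < eps by rewrite invf_plt // truncnS_gt.
have tr (x : R) : 0 <= x -> (Num.truncn x)%:R <= x < (Num.truncn x)%:R + 1.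
  by move=> x0; rewrite natr1; apply: truncn_itv.
pose t (j : nat) : nat := Num.truncn (j%:R * a).
pose fr (j : nat) : R := j%:R * a - (t j)%:R.
have tE j : (t j)%:R <= j%:R * a < (t j)%:R + 1 by apply: tr; rewrite mulr_ge0 // ltW.
have fr0 j : 0 <= fr j < 1 by rewrite /fr; have := tE j; lra.
have cellP j : (Num.truncn (N%:R * fr j) < N)%N.
  have /andP[f0 f1] := fr0 j.
  rewrite truncn_lt_nat; last by rewrite mulr_ge0 // ltW.
  by rewrite gtr_pMr.
pose f (j : 'I_N.+1) : 'I_N := Ordinal (cellP j).
have : ~~ injectiveb f.
  by apply/injectiveP => /leq_card; rewrite !card_ord ltnn.
case/injectivePn => x [y xy fxy].
wlog ltxy : x y xy fxy / (x < y)%N.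
  move=> wl; case: (ltngtP x y) => [||/ord_inj exy]; [exact: wl|apply: wl|].
    - by rewrite eq_sym.
    - by [].
  by rewrite exy eqxx in xy.
have close : - N%:R^-1 < fr y - fr x < N%:R^-1.
  have cx := tr (N%:R * fr x); have cy := tr (N%:R * fr y).
  have {fxy} : Num.truncn (N%:R * fr x) = Num.truncn (N%:R * fr y).
    by have /(congr1 val) := fxy.
  move=> Exy; rewrite Exy in cx.
  have {cx} := cx (mulr_ge0 (ltW N0) (proj1 (andP (fr0 x)))).
  have {cy} := cy (mulr_ge0 (ltW N0) (proj1 (andP (fr0 y)))).
  move=> hy hx; have : -1 < N%:R * (fr y - fr x) < 1 by rewrite mulrBr; lra.
  move=> /andP[h1 h2]; apply/andP; split.
    by rewrite -(ltr_pM2l N0) mulrN mulfV ?gt_eqF.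
  by rewrite -(ltr_pM2l N0) mulfV ?gt_eqF.
have txy : (t x <= t y)%N.
  by apply: le_truncn; rewrite ler_pM2r // ler_nat ltnW.
pose q := (y - x)%N; pose n := (t y - t x)%N.
have dE : fr y - fr x = q%:R * a - n%:R.
  by rewrite /q /n !natrB ?(ltnW ltxy) // /fr; ring.
have q0 : (0 < q)%N by rewrite subn_gt0.
rewrite dE in close.
have [d0|d0|d0] := ltgtP (q%:R * a - n%:R) 0; last first.
- by case: irr; exists q, n; split=> //; lra.
- by exists q, n; lra.
(* walk down by the negative step until the sum passes [-1], then add [1] *)
pose d := n%:R - q%:R * a.
have d_gt0 : 0 < d by rewrite /d; lra.
have d1 : d < 1.
  have : N%:R^-1 <= 1 :> R by rewrite invf_le1 // ler1n.
  by rewrite /d; lra.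
pose m := Num.truncn d^-1.
have /andP[m1 m2] : m%:R <= d^-1 < m%:R + 1 by apply: tr; rewrite invr_ge0 ltW.
have md : m%:R * d <= 1 by rewrite -ler_pdivlMr // div1r.
have md' : 1 < m%:R * d + d.
  by rewrite -[X in _ + X]mul1r -mulrDl -ltr_pdivrMr // div1r.
have m0 : (0 < m)%N by rewrite /m truncn_gt0 invf_ge1 // ltW.
have n0 : (0 < n)%N.
  rewrite lt0n; apply/eqP => n0; move: d_gt0; rewrite /d n0.
  have : 0 < q%:R * a by rewrite mulr_gt0 // ltr0n.
  by lra.
have mdE : m%:R * d = (m * n)%:R - (m * q)%:R * a by rewrite /d !natrM; ring.
exists (m * q)%N, (m * n - 1)%N.
rewrite natrB; last by rewrite muln_gt0 m0.
have [md1|md1] := eqVneq (m%:R * d) 1.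
  case: irr; exists (m * q)%N, (m * n - 1)%N; split; first by rewrite muln_gt0 m0.
  by rewrite natrB ?muln_gt0 ?m0 //; move: mdE; rewrite md1 => mdE; lra.
have {md md1} : m%:R * d < 1 by rewrite lt_neqAle md1.
have : d < N%:R^-1 by rewrite /d; lra.
move: Neps md' mdE; clearbody d; lra.
Qed.

(** With [Q] a common denominator, the generator is [d / Q], where [d] is the least positive integer
    obtained from the numerators [p E] and [- Q] with nonnegative coefficients. Signs matter because
    a word uses each symbol a nonnegative number of times. *)
Lemma rational_lattice (R : realType) (L : finType) (alpha : L -> R) (E0 : L) :
  (forall E, 0 < alpha E) ->
  (forall E, exists q n : nat, (0 < q)%N /\ q%:R * alpha E = n%:R) ->
  exists g : R, [/\ 0 < g, exists p : nat, 1 = p%:R * g,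
    forall E, exists p : nat, alpha E = p%:R * g,
    exists Q : nat, (0 < Q)%N /\ forall E, exists p : nat, Q%:R * alpha E = p%:R
  & exists (m : L -> nat) (n : nat), \sum_E (m E)%:R * alpha E = g + n%:R].
Proof.
move=> a0 rat.
have [Q [Q0 intQ]] : exists Q : nat, (0 < Q)%N /\ forall E, exists p : nat, Q%:R * alpha E = p%:R.
  have [q hq] := choice rat.
  exists (\prod_E q E)%N; split; first by rewrite prodn_gt0 // => E; have [? []] := hq E.
  move=> E; have [n [_ qn]] := hq E; exists ((\prod_(E' | E' != E) q E') * n)%N.
  by rewrite (bigD1 E) //= mulnC !natrM -mulrA qn.
have [p hp] := choice intQ.
have QR : 0 < Q%:R :> R by rewrite ltr0n.
have aE E : alpha E = (p E)%:R / Q%:R by rewrite -hp mulrC mulKf // gt_eqF.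
have p0 E : (0 < p E)%N by rewrite -(ltr0n R) -hp mulr_gt0.
pose P (d : nat) := (0 < d)%N /\ exists (m : L -> nat) (n : nat), (\sum_E m E * p E = d + n * Q)%N.
have exP : exists d, `[< P d >].
  exists Q; apply/asboolP; split=> //; exists (fun E => (E == E0) * (2 * Q))%N, (2 * p E0 - 1)%N.
  rewrite (bigD1 E0) //= eqxx big1 ?addn0; last by move=> E /negPf ->.
  by have := p0 E0; nia.
have [d /asboolP[d0 [m [n mn]]] dmin] := ex_minnP exP.
have {}dmin r : P r -> (d <= r)%N by move=> Pr; apply: dmin; apply/asboolP.
have dvdp E : (d %| p E)%N.
  have := divn_eq (p E) d; set u := (p E %/ d)%N; set r := (p E %% d)%N => pE.
  have rd : (r < d)%N by rewrite ltn_pmod.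
  rewrite /dvdn -/r; apply/eqP; case: (posnP r) => // r0.
  suff /dmin : P r by rewrite leqNgt rd.
  (* The division would need the coefficient [-u]; modulo [Q] this is [u * (Q - 1)], which is
     nonnegative, and the surplus goes into the multiple of [Q]. *)
  split=> //; exists (fun E' => (E' == E) + u * (Q - 1) * m E')%N, (u * d + u * (Q - 1) * n)%N.
  under eq_bigr do rewrite mulnDl -mulnA.
  rewrite big_split /= -big_distrr /= mn (bigD1 E) //= eqxx big1 ?addn0; last first.
    by move=> E' /negPf ->.
  by rewrite mul1n pE; nia.
have dvdQ : (d %| Q)%N.
  have := divn_eq Q d; set u := (Q %/ d)%N; set r := (Q %% d)%N => QE.
  have rd : (r < d)%N by rewrite ltn_pmod.
  rewrite /dvdn -/r; apply/eqP; case: (posnP r) => // r0.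
  suff /dmin : P r by rewrite leqNgt rd.
  split=> //; exists (fun E' => (E' == E0) * Q + u * (Q - 1) * m E')%N.
  exists (u * d + u * (Q - 1) * n + (p E0 - 1))%N.
  under eq_bigr do rewrite mulnDl -[X in (_ + X)%N]mulnA.
  rewrite big_split /= -big_distrr /= mn (bigD1 E0) //= eqxx big1 ?addn0; last first.
    by move=> E' /negPf ->.
  by have := p0 E0; nia.
exists (d%:R / Q%:R); split.
- by rewrite divr_gt0 // ltr0n.
- by exists (Q %/ d)%N; rewrite mulrA -natrM divnK // mulfV // gt_eqF.
- by move=> E; exists (p E %/ d)%N; rewrite mulrA -natrM divnK.
- by exists Q.
exists m, n; under eq_bigr do rewrite aE mulrA -natrM.
rewrite -mulr_suml -natr_sum mn natrD natrM mulrDl mulfK // gt_eqF //.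
Qed.

(** * Walks of chain values on the circle *)

Section Words.
Variables (R : realType) (L : finType) (ar : L -> nat) (alpha : L -> R).
Hypothesis har : forall E, (2 <= ar E)%N.
Hypothesis halpha : forall E, 0 < alpha E <= 1.

(* [U] is the value of the partial chain before the symbol [E] is used.  The
   condition [U + eta <= alpha E] at a link makes every proper part of the final chain
   have nonnegative value. *)
Definition ustep U E : R := if alpha E <= U then U - alpha E else U - alpha E + 1.

Fixpoint walk (eta U : R) (es : seq L) F : Prop :=
  match es with
  | [::] => U - alpha F = - eta
  | E :: es' => (alpha E <= U \/ U + eta <= alpha E) /\ walk eta (ustep U E) es' F
  end.

Fixpoint links (U : R) (es : seq L) : nat :=
  match es with
  | [::] => 0
  | E :: es' => ~~ (alpha E <= U)%R + links (ustep U E) es'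
  end.

(** The number of points of [W] consumed by a chain: a pendant hyperedge contains one chain vertex
    and a link two. The closing symbol [F] is pendant. *)
Fixpoint slots (U : R) (es : seq L) F : nat :=
  match es with
  | [::] => (ar F).-1
  | E :: es' => (if (alpha E <= U)%R then (ar E).-1 else (ar E).-2) + slots (ustep U E) es' F
  end.

Lemma ustep_range (U : R) E : 0 <= U <= 1 -> 0 <= ustep U E < 1.
Proof.
move=> /andP[U0 U1]; have /andP[a0 a1] := halpha E; rewrite /ustep.
by case: (leP (alpha E) U) => h; apply/andP; split; lra.
Qed.

Lemma ustep_range1 (U : R) E : 0 <= U <= 1 -> 0 <= ustep U E <= 1.
Proof. by move=> /(ustep_range E)/andP[-> /ltW]. Qed.

Lemma foldl_ustep U es :
  foldl ustep U es = U - \sum_(E <- es) alpha E + (links U es)%:R.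
Proof.
elim: es U => [|E es IH] U /=; first by rewrite big_nil subr0 addr0.
by rewrite IH big_cons natrD /ustep; case: (leP (alpha E) U) => _ /=; ring.
Qed.

Lemma foldl_ustep_range (U : R) es : 0 <= U <= 1 -> 0 <= foldl ustep U es <= 1.
Proof. by elim: es U => [|E es IH] U //= U01; apply/IH/ustep_range1. Qed.

Lemma foldl_ustep_lt1 (U : R) es : 0 <= U <= 1 -> es != [::] -> foldl ustep U es < 1.
Proof.
case/lastP: es => // es E U01 _; rewrite -cats1 foldl_cat /=.
by have /andP[_ ->] := ustep_range E (foldl_ustep_range es U01).
Qed.

(** The value never leaves [[0, 1]], so the total weight determines the number of links up to 1. *)
Lemma links_ge es : \sum_(E <- es) alpha E - 1 <= (links 1 es)%:R.
Proof.
have /andP[] := @foldl_ustep_range 1 es (introT andP (conj ler01 (lexx 1))).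
by rewrite foldl_ustep; lra.
Qed.

Lemma links_le es : (links 1 es)%:R <= \sum_(E <- es) alpha E.
Proof.
have /andP[] := @foldl_ustep_range 1 es (introT andP (conj ler01 (lexx 1))).
by rewrite foldl_ustep; lra.
Qed.

Lemma slotsE U es F :
  (slots U es F)%:R = \sum_(E <- es) ((ar E)%:R - 1) - (links U es)%:R + (ar F)%:R - 1 :> R.
Proof.
have arE E : (ar E).-2%:R = (ar E)%:R - 2%:R :> R /\ (ar E).-1%:R = (ar E)%:R - 1 :> R.
  by have := har E; case: (ar E) => [|[|k]] //= _; rewrite -[in k.+2%:R]addn2 -addn1 !natrD; split; ring.
elim: es U => [|E es IH] U /=; first by rewrite big_nil (arE F).2; ring.
rewrite natrD IH big_cons natrD; case: (leP (alpha E) U) => _ /=; rewrite ?(arE E).1 ?(arE E).2; ring.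
Qed.

Lemma sum_count (f : L -> R) es E0 : (forall E, 0 <= f E) ->
  (count_mem E0 es)%:R * f E0 <= \sum_(E <- es) f E.
Proof.
move=> f0; elim: es => [|E es IH] /=; first by rewrite big_nil mul0r.
rewrite big_cons natrD mulrDl; apply: lerD => //.
by have [->|_] := eqVneq E E0; rewrite ?mul1r ?mul0r.
Qed.

(** The links number at most the total weight, so each use of [E0] accounts for
    [ar E0 - 1 - alpha E0] slots. This is positive unless [E0] is binary of weight 1. *)
Lemma slots_ge es F E0 :
  (count_mem E0 es)%:R * ((ar E0)%:R - 1 - alpha E0) <= (slots 1 es F)%:R :> R.
Proof.
have ar2 E : 2%:R <= (ar E)%:R :> R by rewrite ler_nat.
have f0 E : 0 <= (ar E)%:R - 1 - alpha E.
  by have := ar2 E; have /andP[_] := halpha E; lra.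
apply: le_trans (@sum_count (fun E => (ar E)%:R - 1 - alpha E) es E0 f0) _.
rewrite slotsE sumrB.
by have := links_le es; have := ar2 F; lra.
Qed.

(** Under this condition every predimension is an integer multiple of [g], so a nonnegative
    difference of predimensions below [g] vanishes. *)
Definition lattice (g : R) :=
  (exists p : nat, 1 = p%:R * g) /\ (forall E, exists p : nat, alpha E = p%:R * g).

(** All values are multiples of [g], so [U < alpha E] already gives [U + g <= alpha E], the
    condition at a link. *)
Lemma walk_lattice g (U : R) es F : 0 < g -> lattice g -> 0 <= U <= 1 ->
  (exists a : nat, U = a%:R * g) -> foldl ustep U es = alpha F - g -> walk g U es F.
Proof.
move=> g0 [[q q1] lat]; elim: es U => [|E es IH] U /= U01 [a Ua]; first by move->; lra.
move=> fin; have [p pE] := lat E.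
have lin (b c : nat) : (b%:R * g <= c%:R * g) = (b <= c)%N by rewrite ler_pM2r // ler_nat.
split.
  have [le_aU|lt_Ua] := leP (alpha E) U; [by left|right].
  move: lt_Ua; rewrite ltNge pE Ua lin -ltnNge => lt_ap.
  by rewrite -[X in _ + X]mul1r -mulrDl natr1 lin.
apply: IH => //; first exact: ustep_range1.
rewrite /ustep; have [|lt_Ua] := leP (alpha E) U.
  by rewrite pE Ua lin => pa; exists (a - p)%N; rewrite natrB // mulrBl.
exists (a + q - p)%N; rewrite natrB ?natrD; first by rewrite pE Ua mulrBl mulrDl -q1; ring.
have /andP[_ ] := halpha E; rewrite pE [X in _ <= X]q1 lin => /leq_trans; apply.
exact: leq_addl.
Qed.

(* The value before the last symbol [F] is congruent to [alpha F - g] modulo 1 and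
   lies in [0, 1), hence equals it. *)
Lemma word_lattice (E0 : L) (K : nat) :
  (forall E, exists q n : nat, (0 < q)%N /\ q%:R * alpha E = n%:R) ->
  exists (g : R) es F, [/\ 0 < g, lattice g, walk g 1 es F & (K <= count_mem E0 es)%N].
Proof.
move=> rat.
have [//|g [g0 g1 gE [Q [Q0 intQ]] [m [n mn]]]] := rational_lattice E0 _ rat.
  by move=> E; case/andP: (halpha E).
(* The extra copies of [E0] have integer total weight, so the sum stays congruent to [g] modulo 1.
   With [K + 2] of them, removing the closing symbol leaves a nonempty word that still has [K]. *)
pose m' E := (m E + (E == E0) * (Q * K.+2))%N.
have [p hp] := intQ E0.
have mn' : \sum_E (m' E)%:R * alpha E = g + (n + p * K.+2)%:R.
  rewrite /m'; under eq_bigr do rewrite natrD mulrDl.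
  rewrite big_split /= mn natrD addrA; congr (_ + _).
  rewrite (bigD1 E0) //= eqxx big1 => [|E /negPf ->]; last by rewrite mul0n mul0r.
  by rewrite mul1n !natrM addr0 mulrAC hp.
pose s := flatten [seq nseq (m' E) E | E <- enum L].
have sums : \sum_(E <- s) alpha E = g + (n + p * K.+2)%:R.
  rewrite -mn' big_flatten /= big_map big_enum /=; apply: eq_bigr => E _.
  by rewrite big_nseq; elim: (m' E) => [|k IH] /=; rewrite ?mul0r // IH -natr1 mulrDl mul1r addrC.
have cnts : (K.+2 <= count_mem E0 s)%N.
  rewrite count_flatten -map_comp sumnE big_map big_enum /= (bigD1 E0) //=.
  rewrite count_nseq /= eqxx mul1n /m' eqxx; nia.
case Es: s cnts sums => [|F es] //= cnts; rewrite big_cons => sums.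
exists g, es, F; split=> //; last first.
  by move: cnts; case: (F == E0) => /=; lia.
have U01 : 0 <= (1 : R) <= 1 by rewrite ler01 lexx.
apply: walk_lattice => //.
have es0 : es != [::].
  by apply/eqP => es0; move: cnts; rewrite es0 /=; case: (_ == _).
have := foldl_ustep_lt1 U01 es0; have /andP[] := foldl_ustep_range es U01.
rewrite foldl_ustep.
have -> : \sum_(E <- es) alpha E = g + (n + p * K.+2)%:R - alpha F by rewrite -sums; ring.
set c := links 1 es; set N := (n + _)%N => h0 h1 h2.
have [q qF] := gE F.
have gF : g <= alpha F.
  have /andP[aF _] := halpha F; move: aF; rewrite qF pmulr_lgt0 // ltr0n => q0.
  by rewrite ler_peMl ?ler1n ?(ltW g0).
have /andP[_ aF1] := halpha F.
suff cN : (c.+1 = N)%N by rewrite -cN -natr1; ring.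
by apply/eqP; rewrite eqn_leq; apply/andP; split; rewrite -ltnS -(ltr_nat R) -!natr1; lra.
Qed.

Lemma walk_nseq eta U E l :
  (forall j, (j < l)%N -> let V := iter j (ustep^~ E) U in alpha E <= V \/ V + eta <= alpha E) ->
  iter l (ustep^~ E) U - alpha E = - eta -> walk eta U (nseq l E) E.
Proof.
elim: l U => [|l IH] U //= hj hl; split; first exact: (hj 0).
by apply: IH => [j jl|]; rewrite -iterSr //; apply: (hj j.+1).
Qed.

Lemma foldl_nseq U E l : foldl ustep U (nseq l E) = iter l (ustep^~ E) U.
Proof. by elim: l U => [|l IH] U //=; rewrite IH -iterSr. Qed.

(* Stopping at the first time the value enters [(alpha E - e, alpha E)] guarantees
   that all earlier links satisfy the condition of [walk]. *)
Lemma word_dense (E : L) (K : nat) (eps : R) : 0 < eps ->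
  (forall e, 0 < e -> exists q n : nat, 0 < q%:R * alpha E - n%:R < e) ->
  exists (eta : R) l, [/\ 0 < eta, eta <= eps, walk eta 1 (nseq l E) E & (K <= l)%N].
Proof.
move=> eps0 dense; have /andP[aE0 aE1] := halpha E.
pose V j := iter j (ustep^~ E) 1.
have U01 : 0 <= (1 : R) <= 1 by rewrite ler01 lexx.
have V01 j : 0 <= V j <= 1 by rewrite /V -foldl_nseq foldl_ustep_range.
(* Including the gaps of the first [K] values rules out stopping before time [K]. *)
pose e := \big[Num.min/Num.min eps (alpha E)]_(j < K | V j < alpha E) (alpha E - V j).
have e0 : 0 < e.
  apply: (big_ind (fun x => 0 < x)) => [|x y x0 y0|j]; rewrite ?lt_min ?eps0 ?x0 //.
  by rewrite subr_gt0.
have e_le : e <= Num.min eps (alpha E) by apply: bigmin_le_id.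
move: e_le; rewrite le_min => /andP[e_eps e_a].
pose P l := 0 < alpha E - V l < e.
have exP : exists l, P l.
  have [q [n qn]] := dense e e0.
  have q0 : (0 < q)%N.
    case: q qn => // /andP[]; rewrite mul0r sub0r oppr_gt0 => /lt_le_trans/(_ (ler0n _ n)).
    by rewrite ltxx.
  (* The two sides are congruent modulo 1; the left lies in [[0, 1]] and the right strictly between
     0 and 1, so they agree. *)
  exists q.-1; rewrite /P; suff -> : V q.-1 = alpha E - (q%:R * alpha E - n%:R) by lra.
  have := V01 q.-1; rewrite /V -foldl_nseq foldl_ustep big_nseq.
  have -> : iter q.-1 (+%R (alpha E)) 0 = q%:R * alpha E - alpha E.
    rewrite -[in q%:R](prednK q0) -natr1 mulrDl mul1r addrK.
    by elim: q.-1 => [|k IH] /=; rewrite ?mul0r // IH -natr1 mulrDl mul1r addrC.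
  set c := links _ _; move: qn; set Y := q%:R * alpha E => qn cn.
  suff cN : c.+1 = n by rewrite -cN -natr1; ring.
  apply/eqP; rewrite eqn_leq; apply/andP; split; rewrite -ltnS -(ltr_nat R) -!natr1; lra.
have [l Pl lmin] := ex_minnP exP.
have /andP[l0 l1] := Pl.
exists (alpha E - V l), l; split=> //; first lra.
  apply: walk_nseq; last by rewrite -/(V l); ring.
  move=> j jl /=; rewrite -/(V j).
  have [|lt] := leP (alpha E) (V j); [by left|right].
  have : ~~ P j by apply: contraL jl => /lmin; rewrite leqNgt.
  by rewrite /P subr_gt0 lt /= -leNgt; lra.
rewrite leqNgt; apply/negP => lK; move: l1; rewrite ltNge => /negP; apply.
apply: (bigmin_le_cond _ (j := Ordinal lK)) => /=; lra.
Qed.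

Hypothesis hnot : ~ (forall E : L, ar E = 2%N /\ alpha E = 1).

(** If all weights are rational, the lattice generator serves as [eta], and [hnot] provides a symbol
    each of whose uses yields a positive amount of slots. Otherwise one symbol of irrational weight
    is repeated; its weight is below 1, so it yields slots as well. *)
Lemma word_exists (eps : R) (K : nat) : 0 < eps ->
  exists (eta : R) es F, [/\ 0 < eta, forall E, eta <= alpha E, eta <= eps \/ lattice eta,
    walk eta 1 es F & (K <= links 1 es)%N /\ (K <= slots 1 es F)%N].
Proof.
move=> eps0.
have ar2 E : 2%:R <= (ar E)%:R :> R by rewrite ler_nat.
have enough E0 : 0 < (ar E0)%:R - 1 - alpha E0 -> exists K', forall es F,
    (K' <= count_mem E0 es)%N -> (K <= links 1 es)%N /\ (K <= slots 1 es F)%N.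
  set k := _ - alpha E0 => k0; have /andP[a0 _] := halpha E0.
  exists (Num.bound (K.+1%:R / alpha E0) + Num.bound (K%:R / k))%N => es F cK.
  have h1 : K.+1%:R < (count_mem E0 es)%:R * alpha E0.
    rewrite -ltr_pdivrMr //; apply: lt_le_trans (archi_boundP _) _.
      by rewrite divr_ge0 // ltW.
    by rewrite ler_nat (leq_trans _ cK) // leq_addr.
  have h2 : K%:R < (count_mem E0 es)%:R * k.
    rewrite -ltr_pdivrMr //; apply: lt_le_trans (archi_boundP _) _.
      by rewrite divr_ge0 // ltW.
    by rewrite ler_nat (leq_trans _ cK) // leq_addl.
  rewrite -!(ler_nat R); split; last by apply: le_trans (ltW h2) (slots_ge _ _ _).
  have a_ge0 E : 0 <= alpha E by case/andP: (halpha E) => /ltW.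
  have := links_ge es; have := sum_count es E0 a_ge0; move: h1; rewrite -natr1; lra.
have [rat|/existsNP[E irr]] :=
    pselect (forall E, exists q n : nat, (0 < q)%N /\ q%:R * alpha E = n%:R).
  have /existsNP[E0 nE0] := hnot.
  have [|K' hK'] := enough E0.
    have /andP[_ a1] := halpha E0; rewrite lt_neqAle eq_sym.
    apply/andP; split; last by have := ar2 E0; lra.
    apply/eqP => eq0; apply: nE0.
    have ar1 : (ar E0)%:R = 2%:R :> R by have := ar2 E0; lra.
    by split; [apply/eqP; rewrite -(eqr_nat R) ar1 | lra].
  have [g [es [F [g0 lat w cK]]]] := word_lattice E0 K' rat.
  exists g, es, F; split=> //; last by apply: hK'; exact: cK.
    move=> E; have [_ /(_ E)[p pE]] := lat; have /andP[a0 _] := halpha E.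
    move: a0; rewrite pE pmulr_lgt0 // ltr0n => p0.
    by rewrite ler_peMl ?ler1n ?(ltW g0).
  by right.
have /andP[a0 a1] := halpha E.
have [/irr //|dense] := small_multiple a0.
have [|K' hK'] := enough E.
  have a_neq1 : alpha E != 1.
    by apply/eqP => aE; apply: irr; exists 1%N, 1%N; rewrite aE mulr1.
  have a_lt1 : alpha E < 1 by rewrite lt_neqAle a_neq1.
  by have := ar2 E; lra.
pose eps' := \big[Num.min/eps]_E' alpha E'.
have eps'0 : 0 < eps'.
  apply: (big_ind (fun x => 0 < x)) => // [x y x0 y0|E' _]; first by rewrite lt_min x0.
  by case/andP: (halpha E').
have [eta [l [eta0 le_eta w Kl]]] := word_dense K' eps'0 dense.
exists eta, (nseq l E), E; split=> //.
- by move=> E'; apply: le_trans le_eta _; apply: bigmin_le.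
- by left; apply: le_trans le_eta (bigmin_le_id _ _ _ _).
by apply: hK'; rewrite count_nseq /= eqxx mul1n.
Qed.

End Words.

(** * Extensions of small relative predimension *)

Lemma fsubset_card_exists (T : choiceType) (A : {fset T}) n :
  (n <= #|` A|)%N -> exists2 J, J `<=` A & #|` J| = n.
Proof.
move=> nA; exists [fset x in take n A].
  by apply/fsubsetP => x; rewrite !inE => /mem_take.
by rewrite card_fseq undup_id ?take_uniq // size_take_min; apply/minn_idPl.
Qed.

Section Gadget.
Variables (R : realType) (L : finType) (ar : L -> nat) (alpha : L -> R).
Hypothesis har : forall E, (2 <= ar E)%N.
Hypothesis halpha : forall E, 0 < alpha E <= 1.
Local Notation dla := (dl alpha).

Definition uniform (T : choiceType) (e : L -> {fset T} -> bool) :=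
  forall E S, e E S -> #|` S| = ar E.

Definition supported (T : choiceType) (e : L -> {fset T} -> bool) (Y : {fset T}) :=
  forall E S, e E S -> S `<=` Y.

Variables (T : choiceType) (fresh : pred T).
Hypothesis fresh_inf : forall Y : {fset T}, exists2 x, fresh x & x \notin Y.

Section OneGadget.
Variables (e0 : L -> {fset T} -> bool) (Y0 W : {fset T}) (eta : R).
Hypothesis uni0 : uniform e0.
Hypothesis sup0 : supported e0 Y0.
Hypothesis WY0 : W `<=` Y0.
Hypothesis eta_le : forall E, eta <= alpha E.

(* [V] are the new vertices, [v] the last of them, [Us] the points of [W] used so
   far, and [U] the value of the partial gadget over [Y0]. *)
Record gstate (e : L -> {fset T} -> bool) (V : {fset T}) v (Us : {fset T}) (U : R) : Prop :=
  GState {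
    g_uni : uniform e;
    g_v : v \in V;
    g_new : forall x, x \in V -> x \notin Y0 /\ fresh x;
    g_Us : Us `<=` W;
    g_sup : supported e (Y0 `|` V);
    g_agree : forall E S, S `<=` Y0 -> e E S = e0 E S;
    g_used : forall E S, e E S -> ~~ (S `<=` Y0) -> S `&` Y0 `<=` Us;
    g_out : forall D, D `<=` Y0 `|` V -> v \notin D -> dla e0 (D `&` Y0) <= dla e D;
    g_in : forall D, D `<=` Y0 `|` V -> v \in D -> dla e0 (D `&` Y0) + U <= dla e D;
    g_proper : forall D, D `<=` Y0 `|` V -> v \in D -> ~~ (V `|` Us `<=` D) ->
      dla e0 (D `&` Y0) + U + eta <= dla e D;
    g_full : dla e (Y0 `|` V) = dla e0 Y0 + U }.

Lemma gstate_init v : v \notin Y0 -> fresh v -> gstate e0 [fset v] v fset0 1.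
Proof.
move=> vY fv.
have vS E S : e0 E S -> v \notin S by move=> /sup0/fsubsetP SY; apply: contra vY => /SY.
have YU : Y0 `|` [fset v] = v |` Y0 by rewrite fsetUC.
have inE' D : D `<=` v |` Y0 -> v \in D -> dla e0 D = dla e0 (D `&` Y0) + 1.
  move=> DY vD; rewrite -(@dl_isolated _ _ _ _ _ _ v) //; last by rewrite !inE (negPf vY) andbF.
  congr (dla _ _); apply/fsetP => x; rewrite !inE; have [->|xv] := eqVneq x v; first by rewrite vD.
  rewrite orFb; apply/idP/andP => [xD|[]//]; split=> //.
  by have := fsubsetP DY x xD; rewrite !inE (negPf xv).
split=> //; rewrite ?YU ?fset11 //.
- by move=> x; rewrite inE => /eqP->.
- by move=> E S /sup0/fsubset_trans; apply; apply: fsubsetUr.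
- by move=> E S /sup0 ->.
- move=> D DY vD; suff -> : D `&` Y0 = D by [].
  apply/fsetIidPl/fsubsetP => x xD; have := fsubsetP DY x xD; rewrite !inE => /orP[/eqP xv|//].
  by rewrite -xv xD in vD.
- by move=> D DY vD; rewrite (inE' D).
- by move=> D DY vD; rewrite fsetU0 fsub1set vD.
- by rewrite dl_isolated.
Qed.

(** For the slack of a proper part: a set missing the new hyperedge saves [alpha E], which is at
    least [eta]; a set containing it must already miss an older vertex or used point. *)
Lemma gstate_pendant e V v Us U E J : gstate e V v Us U ->
  J `<=` W `\` Us -> #|` J| = (ar E).-1 ->
  gstate (add_edge e E (v |` J)) V v (Us `|` J) (U - alpha E).
Proof.
move=> g JW cJ; set S0 := v |` J.
have [vY _] := g_new g (g_v g).
have JWU x : x \in J -> (x \in W) && (x \notin Us).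
  by move=> /(fsubsetP JW); rewrite !inE andbC.
have JY x : x \in J -> x \in Y0 by move=> /JWU/andP[xW _]; apply: (fsubsetP WY0).
have vJ : v \notin J by apply: contra vY => /JY.
have S0Y : ~~ (S0 `<=` Y0).
  by apply: contra vY => /fsubsetP; apply; rewrite !inE eqxx.
have S0e : ~~ e E S0.
  apply/negP => eS0; have /fsubsetP sub := g_used g eS0 S0Y.
  have : (0 < #|` J|)%N by rewrite cJ; have := har E; case: (ar E) => [|[]].
  rewrite cardfs_gt0 => /fset0Pn[x xJ]; have /andP[_ /negP] := JWU _ xJ; apply.
  by apply: sub; rewrite !inE xJ JY ?orbT.
have S0V : S0 `<=` Y0 `|` V.
  by apply/fsubsetP => x; rewrite !inE => /orP[/eqP->|/JY->//]; rewrite (g_v g) orbT.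
have aE0 : 0 <= alpha E by apply: alpha_ge0.
have dlE D := dl_add_edge alpha D S0e.
split.
- move=> E' S /orP[/(g_uni g)//|/andP[/eqP-> /eqP->]].
  by rewrite cardfsU1 vJ cJ; have := har E; case: (ar E).
- exact: g_v g.
- exact: g_new g.
- rewrite fsubUset (g_Us g); apply/fsubsetP => x /JWU/andP[] //.
- by move=> E' S /orP[/(g_sup g)//|/andP[_ /eqP->]].
- move=> E' S SY; rewrite /add_edge (g_agree g) //.
  by case: (S =P S0) SY S0Y => [-> ->|]; rewrite ?andbF ?orbF.
- move=> E' S /orP[eS nS|/andP[_ /eqP->] _].
    exact: fsubset_trans (g_used g eS nS) (fsubsetUl _ _).
  apply/fsubsetP => x; rewrite !inE => /andP[/orP[/eqP->|->]]; last by rewrite orbT.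
  by rewrite (negPf vY).
- move=> D DY vD; rewrite dlE; case: ifP => [/fsubsetP S0D|_].
    by rewrite S0D ?fset1U1 in vD.
  by rewrite subr0 (g_out g).
- move=> D DY vD; rewrite dlE; have := g_in g DY vD.
  by case: ifP => _; lra.
- move=> D DY vD nD; rewrite dlE; case: ifP => [S0D|_]; last first.
    by have := g_in g DY vD; have := eta_le E; lra.
  suff /(g_proper g DY vD) : ~~ (V `|` Us `<=` D) by lra.
  apply: contra nD => VU; rewrite fsetUA fsubUset VU.
  by apply: fsubset_trans S0D; apply: fsubsetUr.
- by rewrite dlE S0V (g_full g) addrA.
Qed.

(** A set with the new vertex [v'] but without [v] gains a whole point and no hyperedge. Its slack
    over the new value [U - alpha E + 1] is [alpha E - U], whence the condition
    [U + eta <= alpha E]. *)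
Lemma gstate_link e V v Us U E J v' : gstate e V v Us U ->
  0 <= U <= 1 -> U + eta <= alpha E -> 0 < eta ->
  v' \notin Y0 `|` V -> fresh v' ->
  J `<=` W `\` Us -> #|` J| = (ar E).-2 ->
  gstate (add_edge e E (v |` (v' |` J))) (v' |` V) v' (Us `|` J) (U - alpha E + 1).
Proof.
move=> g /andP[U0 U1] Ua eta0 v'YV fv' JW cJ; set S0 := v |` _.
have [vY _] := g_new g (g_v g).
have JWU x : x \in J -> (x \in W) && (x \notin Us).
  by move=> /(fsubsetP JW); rewrite !inE andbC.
have JY x : x \in J -> x \in Y0 by move=> /JWU/andP[xW _]; apply: (fsubsetP WY0).
have vJ : v \notin J by apply: contra vY => /JY.
have v'Y : v' \notin Y0 by apply: contra v'YV; rewrite !inE => ->.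
have v'V : v' \notin V by apply: contra v'YV; rewrite !inE orbC => ->.
have v'J : v' \notin J by apply: contra v'Y => /JY.
have vv' : v != v' by apply: contraNneq v'V => <-; apply: g_v g.
have v'S E' S : e E' S -> v' \notin S.
  by move=> /(g_sup g)/fsubsetP SYV; apply: contra v'YV => /SYV.
have v'S0 : v' \in S0 by rewrite !inE eqxx orbT.
have vS0 : v \in S0 by rewrite !inE eqxx.
have S0Y : ~~ (S0 `<=` Y0) by apply: contra vY => /fsubsetP; apply.
have S0e : ~~ e E S0 by apply: contraL v'S0 => /v'S.
have S0V : S0 `<=` Y0 `|` (v' |` V).
  apply/fsubsetP => x; rewrite !inE.
  by case/or3P => [/eqP->|->|/JY->]; rewrite ?(g_v g) ?orbT.
have aE0 : 0 <= alpha E by apply: alpha_ge0.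
have dlE D := dl_add_edge alpha D S0e.
have oldD D : D `<=` Y0 `|` (v' |` V) -> D `\ v' `<=` Y0 `|` V.
  move=> /fsubsetP DY; apply/fsubsetP => x; rewrite !inE => /andP[xv' /DY].
  by rewrite !inE (negPf xv').
have dlD D : v' \in D -> dla e D = dla e (D `\ v') + 1.
  by move=> v'D; rewrite -(@dl_isolated _ _ _ _ _ _ v') ?fsetD1K ?inE ?eqxx.
have DIY D : D `&` Y0 = (D `\ v') `&` Y0.
  apply/fsetP => x; rewrite !inE; have [->|//] := eqVneq x v'.
  by rewrite (negPf v'Y) !andbF.
split.
- move=> E' S /orP[/(g_uni g)//|/andP[/eqP-> /eqP->]].
  rewrite !cardfsU1 !inE (negPf vv') vJ v'J cJ.
  by have := har E; case: (ar E) => [|[]].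
- by rewrite !inE eqxx.
- move=> x; rewrite !inE => /orP[/eqP->//|/(g_new g)//].
- rewrite fsubUset (g_Us g); apply/fsubsetP => x /JWU/andP[] //.
- move=> E' S /orP[/(g_sup g) SY|/andP[_ /eqP->]//].
  by apply: fsubset_trans SY _; apply: fsetUS; apply: fsubsetUr.
- move=> E' S SY; rewrite /add_edge (g_agree g) //.
  by case: (S =P S0) SY S0Y => [-> ->|]; rewrite ?andbF ?orbF.
- move=> E' S /orP[eS nS|/andP[_ /eqP->] _].
    exact: fsubset_trans (g_used g eS nS) (fsubsetUl _ _).
  apply/fsubsetP => x; rewrite !inE => /andP[/or3P[/eqP->|/eqP->|->]]; last by rewrite orbT.
    by rewrite (negPf vY).
  by rewrite (negPf v'Y).
- move=> D DY v'D; rewrite dlE; case: ifP => [/fsubsetP S0D|_].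
    by rewrite S0D in v'D.
  have DE : D `\ v' = D.
    by apply/fsetP => x; rewrite !inE; have [->|] := eqVneq x v'; rewrite ?(negPf v'D).
  have := oldD _ DY; rewrite DE subr0 => DYV.
  have [vD|vD] := boolP (v \in D); last exact: g_out g _ DYV vD.
  by have := g_in g DYV vD; lra.
- move=> D DY v'D; rewrite dlE dlD // DIY.
  have [vD|vD] := boolP (v \in D `\ v').
    by have := g_in g (oldD _ DY) vD; case: ifP => _; lra.
  have := g_out g (oldD _ DY) vD; case: ifP => [/fsubsetP S0D|_]; last by lra.
  by move: vD; rewrite !inE vv' S0D.
- move=> D DY v'D nD; rewrite dlE dlD // DIY; have := eta_le E => etaE.
  have [vD|vD] := boolP (v \in D `\ v'); last first.
    have := g_out g (oldD _ DY) vD; case: ifP => [/fsubsetP S0D|_]; last by lra.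
    by move: vD; rewrite !inE vv' S0D.
  case: ifP => [S0D|_]; last by have := g_in g (oldD _ DY) vD; lra.
  suff /(g_proper g (oldD _ DY) vD) : ~~ (V `|` Us `<=` D `\ v') by lra.
  apply: contra nD => /fsubsetP VU; apply/fsubsetP => x; rewrite !inE.
  case/orP => [/orP[/eqP->//|xV]|/orP[xU|xJ]].
  + by have := VU x; rewrite !inE xV => /(_ isT)/andP[].
  + by have := VU x; rewrite !inE xU orbT => /(_ isT)/andP[].
  by apply: (fsubsetP S0D); rewrite !inE xJ !orbT.
- rewrite dlE S0V dlD ?inE ?eqxx ?orbT //.
  have -> : (Y0 `|` (v' |` V)) `\ v' = Y0 `|` V.
    apply/fsetP => x; rewrite !inE; have [->|] := eqVneq x v'; last by rewrite orFb.
    by rewrite (negPf v'Y) (negPf v'V).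
  by rewrite (g_full g); ring.
Qed.

Lemma gstate_walk es F e V v Us U : gstate e V v Us U ->
  0 <= U <= 1 -> 0 < eta -> walk alpha eta U es F ->
  #|` W `\` Us| = slots ar alpha U es F ->
  exists e' V' v', gstate e' V' v' W (- eta) /\ #|` V'| = (#|` V| + links alpha U es)%N.
Proof.
move=> + + eta0; elim: es e V v Us U => [|E es IH] e V v Us U g U01 /=.
  (* The closing symbol takes all remaining points of [W], of which exactly [ar F - 1] are left. *)
  move=> finU cW; exists (add_edge e F (v |` (W `\` Us))), V, v; rewrite addn0; split=> //.
  have := gstate_pendant g (fsubset_refl _) cW; rewrite finU.
  suff -> : Us `|` W `\` Us = W by [].
  by rewrite fsetUDl fsetDv fsetD0; apply/fsetUidPr; exact: g_Us g.
case=> cond w cW.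
have jump J n : J `<=` W `\` Us -> #|` J| = n ->
    #|` W `\` Us| = (n + slots ar alpha (ustep alpha U E) es F)%N ->
    #|` W `\` (Us `|` J)| = slots ar alpha (ustep alpha U E) es F.
  by move=> JW cJ cWU; rewrite -fsetDDl cardfsDS // cJ cWU addKn.
have [le_aU|lt_Ua] := leP (alpha E) U.
  rewrite le_aU in cW; have [|J JW cJ] := @fsubset_card_exists _ (W `\` Us) (ar E).-1.
    by rewrite cW leq_addr.
  have := gstate_pendant g JW cJ; have stepU : ustep alpha U E = U - alpha E by rewrite /ustep le_aU.
  rewrite -stepU => /IH; apply=> //; first exact: ustep_range1.
  exact: jump JW cJ cW.
rewrite leNgt lt_Ua /= in cW; have [|J JW cJ] := @fsubset_card_exists _ (W `\` Us) (ar E).-2.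
  by rewrite cW leq_addr.
have [v' fv' v'YV] := fresh_inf (Y0 `|` V).
have Ueta : U + eta <= alpha E by case: cond => // le_aU; move: lt_Ua; rewrite ltNge le_aU.
have := gstate_link g U01 Ueta eta0 v'YV fv' JW cJ.
have stepU : ustep alpha U E = U - alpha E + 1 by rewrite /ustep leNgt lt_Ua.
rewrite -stepU => /IH [|//||e' [V' [v'' [g' cV']]]]; first exact: ustep_range1.
  exact: jump JW cJ cW.
exists e', V', v''; split=> //; rewrite cV' cardfsU1.
by move: v'YV; rewrite !inE negb_or => /andP[_ ->] /=; rewrite addnCA addnA.
Qed.

(** The final value is [-eta], so the slack [eta] in [g_proper] becomes nonnegativity for every set
    that omits part of [V] or of [W]. *)
Lemma gadget es F : 0 < eta -> walk alpha eta 1 es F -> #|` W| = slots ar alpha 1 es F ->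
  exists e V, [/\ uniform e, supported e (Y0 `|` V),
    (forall x, x \in V -> x \notin Y0 /\ fresh x),
    (forall E S, S `<=` Y0 -> e E S = e0 E S) &
    [/\ #|` V| = (links alpha 1 es).+1, dla e (Y0 `|` V) = dla e0 Y0 - eta &
    forall D, D `<=` Y0 `|` V -> dla e0 (D `&` Y0) <= dla e D \/
      V `|` W `<=` D /\ dla e0 (D `&` Y0) - eta <= dla e D]].
Proof.
move=> eta0 w cW; have [v fv vY] := fresh_inf Y0.
have U01 : 0 <= (1 : R) <= 1 by rewrite ler01 lexx.
have cW0 : #|` W `\` fset0| = slots ar alpha 1 es F by rewrite fsetD0.
have [e [V [v' [g cV]]]] := gstate_walk (gstate_init vY fv) U01 eta0 w cW0.
exists e, V; split; [exact: g_uni g|exact: g_sup g|exact: g_new g|exact: g_agree g|].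
split; [by rewrite cV cardfs1|exact: g_full g|].
move=> D DY; have [v'D|v'D] := boolP (v' \in D); last by left; exact: g_out g _ DY v'D.
have [VWD|VWD] := boolP (V `|` W `<=` D).
  by right; split=> //; exact: g_in g _ DY v'D.
by left; have := g_proper g DY v'D VWD; lra.
Qed.

End OneGadget.
(* All copies are attached to the same set [W], and each covers it; this keeps the
   loss zero on sets that do not contain [W]. *)
Lemma gadgets e0 (Y0 W : {fset T}) eta es F (t : nat) :
  uniform e0 -> supported e0 Y0 -> W `<=` Y0 -> (forall E, eta <= alpha E) ->
  0 < eta -> walk alpha eta 1 es F -> #|` W| = slots ar alpha 1 es F ->
  exists e Y, [/\ uniform e, supported e Y, Y0 `<=` Y,
    (forall x, x \in Y -> x \notin Y0 -> fresh x) &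
    [/\ forall E S, S `<=` Y0 -> e E S = e0 E S, #|` Y| = (#|` Y0| + t * (links alpha 1 es).+1)%N,
    dla e Y = dla e0 Y0 - t%:R * eta &
    forall D, D `<=` Y -> dla e0 (D `&` Y0) <= dla e D \/
      [/\ W `<=` D, (links alpha 1 es < #|` D `\` Y0|)%N &
          dla e0 (D `&` Y0) - t%:R * eta <= dla e D]]].
Proof.
move=> uni0 sup0 WY0 eta_le eta0 w cW; elim: t => [|t [e [Y [unie supe Y0Y freY [agre cY fullY subY]]]]].
  exists e0, Y0; split=> // [x ->//|]; split=> // [||D /fsetIidPl->]; rewrite ?addn0 ?mul0r ?subr0 //.
  by left.
have WY := fsubset_trans WY0 Y0Y.
have [e' [V [unie' supe' newV agre' [cV fullV subV]]]] := gadget unie supe WY eta_le eta0 w cW.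
exists e', (Y `|` V); split=> //.
- exact: fsubset_trans Y0Y (fsubsetUl _ _).
- by move=> x; rewrite inE => /orP[/freY//|/newV[_]].
have YV : Y `&` V = fset0.
  by apply/fsetP => x; rewrite !inE; apply/negP => /andP[xY /newV[]]; rewrite xY.
split.
- by move=> E S SY0; rewrite agre' ?agre // (fsubset_trans SY0).
- by rewrite cardfsU YV cardfs0 subn0 cY cV mulSn addnAC addnA.
- by rewrite fullV fullY -natr1; ring.
move=> D DYV; have IDY : D `&` Y `&` Y0 = D `&` Y0.
  by rewrite -fsetIA; congr (_ `&` _); apply/fsetIidPr.
have sub : (D `&` Y) `\` Y0 `<=` D `\` Y0 by apply: fsetSD; apply: fsubsetIl.
have teta : 0 <= t%:R * eta by rewrite mulr_ge0 // ltW.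
have St : t.+1%:R * eta = t%:R * eta + eta by rewrite -natr1 mulrDl mul1r.
have := subY (D `&` Y) (fsubsetIr _ _); rewrite IDY.
case: (subV D DYV) => [lD|[VWD lD]] [lDY|[WD cD lDY]].
- by left; apply: le_trans lDY lD.
- right; split; [exact: fsubset_trans WD (fsubsetIl _ _)| |by lra].
  exact: leq_trans cD (fsubset_leq_card sub).
- right; split; [exact: fsubset_trans (fsubsetUr V W) VWD| |by lra].
  rewrite -cV; apply: fsubset_leq_card; apply/fsubsetP => x xV.
  have [xY _] := newV x xV; rewrite inE (fsubsetP VWD) ?inE ?xV // andbT.
  by apply: contra xY; apply: (fsubsetP Y0Y).
- right; split; [exact: fsubset_trans WD (fsubsetIl _ _)| |by lra].
  exact: leq_trans cD (fsubset_leq_card sub).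
Qed.

Lemma dl_supported e (C D : {fset T}) :
  supported e C -> dla e D = dla e (D `&` C) + (#|` D `\` C|)%:R.
Proof.
move=> supe; rewrite /dl -(cardfsID C D) natrD addrAC; congr (_ - _ + _).
apply: eq_bigr => E _; congr (_ * _%:R); apply: eq_cardfs; apply/fsetP => S.
rewrite !inE /= !fpowersetE fsubsetI; case eS: (e E S); rewrite ?andbF //.
by rewrite (supe _ _ eS) !andbT.
Qed.

Lemma fresh_points (Y : {fset T}) n :
  exists P, #|` P| = n /\ forall x, x \in P -> x \notin Y /\ fresh x.
Proof.
elim: n => [|n [P [cP freP]]]; first by exists fset0; rewrite cardfs0.
have [x fx] := fresh_inf (Y `|` P); rewrite !inE negb_or => /andP[xY xP].
exists (x |` P); rewrite cardfsU1 xP cP; split=> // y; rewrite !inE.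
by move=> /orP[/eqP->//|/freP].
Qed.

Lemma dl_lattice e eta (D : {fset T}) : lattice alpha eta ->
  exists z : int, dla e D = z%:~R * eta.
Proof.
case=> [[q q1] /choice[p pE]].
exists ((#|` D| * q)%:Z - (\sum_E p E * cnt e E D)%N%:Z).
rewrite intrB -!pmulrn mulrBl natrM -mulrA -q1 mulr1 /dl; congr (_ - _).
rewrite natr_sum mulr_suml; apply: eq_bigr => E _.
by rewrite {1}pE natrM mulrAC.
Qed.

Hypothesis hnot : ~ (forall E : L, ar E = 2%N /\ alpha E = 1).

(** Copies of the chain are attached to [W], which is everything in [Y0] outside [C0]. A set over
    [C0] that loses predimension contains [W], hence all of [Y0], whose relative predimension pays
    for the total loss. It also contains a whole chain, which has more than [k] new points. The
    number of copies is bounded in terms of [s], [r] and [eta], which makes [m] uniform. *)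
Lemma small_extension k s (eps : R) : 0 < eps -> exists m, forall e0 (C0 C : {fset T}),
  uniform e0 -> supported e0 C -> C0 `<=` C -> (#|` C| <= s)%N -> 0 <= dla e0 C0 ->
  (forall X, C0 `<=` X -> X `<=` C -> dla e0 C0 <= dla e0 X) ->
  exists e Y, [/\ uniform e, supported e Y, C `<=` Y,
    (forall x, x \in Y -> x \notin C -> fresh x) &
    [/\ forall E S, S `<=` C -> e E S = e0 E S, (#|` Y| <= m)%N, dla e Y < dla e0 C0 + eps,
    (forall X, C0 `<=` X -> X `<=` Y -> dla e0 C0 <= dla e X) &
    (forall X, C `<=` X -> X `<=` Y -> (#|` X `\` C| <= k)%N -> dla e0 C <= dla e X)]].
Proof.
move=> eps0.
have [eta [es [F [eta0 eta_le small w [Kl Ks]]]]] := word_exists har halpha hnot (k + s) eps0.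
set n := links _ _ _ in Kl; set r := slots _ _ _ _ _ in Ks.
exists (s + r + Num.truncn ((s + r)%:R / eta) * n.+1)%N => e0 C0 C uni0 sup0 C0C cC dC0 strong.
have cCr : (#|` C `\` C0| <= r)%N.
  apply: leq_trans (leq_trans (leq_addl k s) Ks).
  by apply: leq_trans cC; apply: fsubset_leq_card; apply: fsubsetDl.
(* Isolated padding points bring [W] to the exact size that the word consumes. *)
have [P [cP freP]] := fresh_points C (r - #|` C `\` C0|).
pose Y0 := C `|` P; pose W := (C `\` C0) `|` P.
have PC x : x \in P -> x \notin C by move=> /freP[].
have sup0' : supported e0 Y0 by move=> E S /sup0/fsubset_trans; apply; apply: fsubsetUl.
have WY0 : W `<=` Y0 by apply: fsetSU; apply: fsubsetDl.
have cW : #|` W| = r.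
  rewrite /W cardfsU cP; suff -> : (C `\` C0) `&` P = fset0 by rewrite cardfs0 subn0 subnKC.
  by apply/fsetP => x; rewrite !inE; apply/negP => /andP[/andP[_ xC] /PC]; rewrite xC.
have Y0C : Y0 `\` C = P.
  apply/fsetP => x; rewrite !inE; have [/PC->|_] := boolP (x \in P); first by rewrite orbT.
  by rewrite orbF andNb.
have dY0 : dla e0 Y0 = dla e0 C + (#|` P|)%:R.
  by rewrite (dl_supported _ sup0) Y0C /Y0 fsetUKC.
pose x := dla e0 C - dla e0 C0 + (#|` P|)%:R.
have x0 : 0 <= x by rewrite /x addr_ge0 // subr_ge0 strong.
(* The largest number of copies whose total loss does not exceed the predimension of [Y0] over
   [C0]. *)
pose t := Num.truncn (x / eta).
have /andP[t1 t2] : t%:R <= x / eta < t.+1%:R by apply: truncn_itv; rewrite divr_ge0 // ltW.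
rewrite ler_pdivlMr // in t1; rewrite ltr_pdivrMr // -natr1 mulrDl mul1r in t2.
have [e [Y [unie supe Y0Y freY [agre cY dY subY]]]] :=
  gadgets t uni0 sup0' WY0 eta_le eta0 w cW.
have CY0 : C `<=` Y0 by apply: fsubsetUl.
exists e, Y; split=> //.
- exact: fsubset_trans CY0 Y0Y.
- move=> y yY yC; have [yP|yP] := boolP (y \in P); first by have [] := freP y yP.
  by apply: freY => //; rewrite !inE negb_or yC.
have dlY0 D : dla e0 (D `&` C) <= dla e0 (D `&` Y0).
  rewrite [leRHS](dl_supported _ sup0) -fsetIA (fsetIidPr CY0).
  by rewrite lerDl.
split.
- by move=> E S SC; apply: agre; apply: fsubset_trans CY0.
- rewrite cY leq_add //.
    apply: leq_trans (leq_card_fsetU _ _) _; apply: leq_add => //.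
    by rewrite cP leq_subr.
  rewrite leq_mul2r; apply/orP; right; apply: le_truncn.
  rewrite ler_pM2r ?invr_gt0 // /x natrD lerD //.
    have := dl_le_card halpha e0 C; have : (#|` C|)%:R <= s%:R :> R by rewrite ler_nat.
    by lra.
  by rewrite ler_nat cP leq_subr.
- have dYE : dla e Y = dla e0 C0 + (x - t%:R * eta) by rewrite dY dY0 /x; ring.
  (* The excess over [C0] is below [eta]. Either [eta <= eps], or the excess is an integer multiple
     of [eta] and so at most 0. *)
  rewrite dYE ltrD2l; case: small => [|lat]; first by lra.
  have [z zE] := dl_lattice e Y lat; have [z0 z0E] := dl_lattice e0 C0 lat.
  have xE : x - t%:R * eta = (z - z0)%:~R * eta.
    by rewrite intrB mulrBl -zE -z0E dYE; ring.
  have : (z - z0)%:~R < 1%:~R :> R by rewrite -(ltr_pM2r eta0) -xE mul1r; lra.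
  rewrite ltr_int => zz0; have : (z - z0)%:~R <= 0%:~R :> R by rewrite ler_int; lia.
  by rewrite -(ler_pM2r eta0) -xE mul0r => /le_lt_trans; apply.
- move=> X C0X XY; case: (subY X XY) => [|[WX _]].
    apply: le_trans; apply: le_trans (dlY0 X); apply: strong; last exact: fsubsetIr.
    by rewrite fsubsetI C0X.
  apply: le_trans; have -> : X `&` Y0 = Y0.
    apply/fsetIidPr/fsubsetP => y; have := fsubsetP C0X y; have := fsubsetP WX y.
    by rewrite !inE; case: (y \in C0); case: (y \in C); case: (y \in P) => //= h h'; rewrite ?h ?h'.
  by rewrite dY0; move: t1; rewrite /x; lra.
move=> X CX XY cX; case: (subY X XY) => [|[_ ]].
  by apply: le_trans; apply: le_trans (dlY0 X); rewrite (fsetIidPr CX).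
move=> /leq_trans/(_ (fsubset_leq_card (fsetDS X CY0)))/leq_trans/(_ cX) nk.
by move: (leq_trans nk (leq_trans (leq_addr s k) Kl)); rewrite ltnn.
Qed.

End Gadget.

(** * Structures and their hypergraphs *)

Section Structures.
Variables (L : finType) (ar : L -> nat).
Implicit Types M N P : lstruct ar.

Definition edge M E (S : {fset M}) : bool :=
  `[< exists t : (ar E).-tuple M, lrel E t /\ S = [fset x in tval t] >].

Lemma lift_tuple (T : choiceType) (A : {fset T}) n (t : n.-tuple T) :
  {subset t <= A} -> exists t' : n.-tuple A, map_tuple val t' = t.
Proof.
move=> tA; have h i : tnth t i \in A by apply: tA; apply: mem_tnth.
exists [tuple [` h i] | i < n]; apply: eq_from_tnth => i.
by rewrite tnth_map tnth_mktuple.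
Qed.

(** Irreflexivity gives [uniq]; two repetition-free tuples with the same range are permutations of
    each other, so symmetry applies. *)
Lemma lrel_edge M (A : {fset M}) E (t : (ar E).-tuple M) : inKL A ->
  {subset t <= A} -> lrel E t = uniq t && edge E [fset x in tval t].
Proof.
move=> KA tA; apply/idP/andP => [rt|[ut /asboolP[t0 [rt0 Et]]]].
  have [t' tE] := lift_tuple tA; split; last by apply/asboolP; exists t.
  by rewrite -tE map_inj_uniq; [apply: (KA E t' t').1; rewrite tE|exact: val_inj].
have t0t : t0 =i t by move=> x; have /fsetP/(_ x) := Et; rewrite !inE.
have t0A : {subset t0 <= A} by move=> x; rewrite t0t => /tA.
have [t' tE] := lift_tuple tA; have [t0' t0E] := lift_tuple t0A.
have ut0 : uniq t0.
  by rewrite -t0E map_inj_uniq; [apply: (KA E t0' t0').1; rewrite t0E|exact: val_inj].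
rewrite -tE (KA E t' t0').2 ?t0E //.
apply: (@perm_map_inj _ _ val); first exact: val_inj.
have -> : map val t' = t by rewrite -tE.
have -> : map val t0' = t0 by rewrite -t0E.
by apply: uniq_perm => // x; rewrite t0t.
Qed.

Lemma edge_card M (A : {fset M}) E (S : {fset M}) : inKL A -> S `<=` A ->
  edge E S -> #|` S| = ar E.
Proof.
move=> KA SA /asboolP[t [rt SE]]; rewrite SE card_fseq.
have tA : {subset t <= A} by move=> x xt; apply: (fsubsetP SA); rewrite SE inE.
by move: rt; rewrite (lrel_edge KA tA) => /andP[ut _]; rewrite undup_id ?size_tuple.
Qed.

(** [NE] counts sets over the finite type [A], [cnt] counts finite subsets of [M]; taking underlying
    values is a bijection between them. *)
Lemma NE_cnt M (A : {fset M}) E : NE A E = cnt (@edge M) E A.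
Proof.
pose phi (S : {set A}) : {fset M} := [fset val x | x in S].
have phiP (S : {set A}) x : (x \in phi S) = [exists y : A, (val y == x) && (y \in S)].
  apply/imfsetP/existsP => /= [[y yS ->]|[y /andP[/eqP<- yS]]]; last by exists y.
  by exists y; rewrite eqxx.
have phi_val (S : {set A}) (y : A) : (val y \in phi S) = (y \in S).
  rewrite phiP; apply/existsP/idP => [[z /andP[/eqP/val_inj-> //]]|yS].
  by exists y; rewrite eqxx.
have phi_inj : injective phi.
  by move=> S1 S2 E12; apply/setP => y; rewrite -!phi_val E12.
have [F FE] : exists F : {fset {set A}}, F = [fset S in [set S : {set A} | holds_on E S]].
  by eexists.
transitivity #|` phi @` F|; first transitivity #|` F|; first by rewrite FE card_finset.
  by rewrite card_in_imfset //= => ? ? _ _; apply: phi_inj.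
apply: eq_cardfs; apply/fsetP => S; rewrite !inE /= fpowersetE FE.
apply/imfsetP/andP => /= [[S']|[SA /asboolP[t [rt SE]]]].
  rewrite !inE => /existsP[t /andP[rt /eqP S'E]] ->; split.
    by apply/fsubsetP => x; rewrite phiP => /existsP[y /andP[/eqP<- _]]; apply: valP.
  exists (map_tuple val t); split=> //.
  apply/fsetP => x; rewrite phiP !inE S'E; apply/existsP/mapP => [[y]|[y yt ->]].
    by rewrite inE => /andP[/eqP<- yt]; exists y.
  by exists y; rewrite eqxx inE.
have tA : {subset t <= A} by move=> x xt; apply: (fsubsetP SA); rewrite SE inE.
have [t' tE] := lift_tuple tA; exists [set x in t'].
  by rewrite !inE; apply/existsP; exists t'; rewrite tE rt eqxx.
apply/fsetP => x; rewrite phiP SE !inE -tE; apply/mapP/existsP => [[y yt ->]|[y]].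
  by exists y; rewrite eqxx inE.
by rewrite inE => /andP[/eqP<- yt]; exists y.
Qed.

Lemma delta_dl (R : realType) (alpha : L -> R) M (A : {fset M}) :
  delta alpha A = dl alpha (@edge M) A.
Proof. by rewrite /delta /dl; under eq_bigr do rewrite NE_cnt. Qed.

(** The map is total and constrained only on [X], so restriction and composition need no
    subtypes. *)
Definition iso_on M N (h : M -> N) (X : {fset M}) :=
  {in X &, injective h} /\
  forall E (t : (ar E).-tuple M), {subset t <= X} -> lrel E (map_tuple h t) = lrel E t.

Lemma imfset_fseq (T T' : choiceType) (h : T -> T') (t : seq T) :
  h @` [fset x in t] = [fset x in map h t].
Proof.
apply/fsetP => y; transitivity (y \in map h t); last by rewrite inE.
apply/imfsetP/mapP => /= -[x].
  by rewrite !inE => xt ->; exists x.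
by move=> xt ->; exists x; rewrite ?inE.
Qed.

Lemma iso_edge M N (h : M -> N) X E (S : {fset M}) :
  iso_on h X -> S `<=` X -> edge E (h @` S) = edge E S.
Proof.
case=> injh hrel SX; apply/asboolP/asboolP => -[t [rt SE]]; last first.
  exists (map_tuple h t); rewrite hrel; first by rewrite SE imfset_fseq.
  by move=> x xt; apply: (fsubsetP SX); rewrite SE inE.
have hx i : exists x, x \in S /\ h x = tnth t i.
  have : tnth t i \in h @` S by rewrite SE inE mem_tnth.
  by case/imfsetP => x /= xS ->; exists x.
have [u hu] := choice hx.
have tE : map_tuple h [tuple u i | i < ar E] = t.
  by apply: eq_from_tnth => i; rewrite tnth_map tnth_mktuple (hu i).2.
have uS x : x \in [tuple u i | i < ar E] -> x \in S.
  by case/tnthP => i ->; rewrite tnth_mktuple (hu i).1.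
exists [tuple u i | i < ar E]; split.
  by rewrite -hrel ?tE // => x /uS; apply: (fsubsetP SX).
apply/fsetP => x; apply/idP/idP => [xS|]; last by rewrite inE => /uS.
rewrite inE.
have : h x \in h @` S by apply: in_imfset.
rewrite SE inE => /tnthP[i hxi].
suff -> : x = u i by apply/tnthP; exists i; rewrite tnth_mktuple.
apply: injh; rewrite ?(fsubsetP SX) ?(hu i).1 //.
by rewrite (hu i).2.
Qed.

Lemma iso_of_edge M N (h : M -> N) (X : {fset M}) : inKL X -> inKL (h @` X) ->
  {in X &, injective h} ->
  (forall E S, S `<=` X -> edge E (h @` S) = edge E S) -> iso_on h X.
Proof.
move=> KX KhX injh hedge; split=> // E t tX.
have htX : {subset map_tuple h t <= h @` X}.
  by move=> _ /mapP[x xt ->]; apply: in_imfset; apply: tX.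
rewrite (lrel_edge KX tX) (lrel_edge KhX htX) /= map_inj_in_uniq; last first.
  by move=> x y xt yt; apply: injh; apply: tX.
rewrite -imfset_fseq hedge //; apply/fsubsetP => x.
by rewrite inE; apply: tX.
Qed.

Lemma iso_sub M N (h : M -> N) (X Y : {fset M}) : Y `<=` X -> iso_on h X -> iso_on h Y.
Proof.
move=> /fsubsetP YX [injh hrel]; split; first by move=> x y /YX xX /YX; apply: injh.
by move=> E t tY; apply: hrel => x /tY/YX.
Qed.

Lemma iso_comp M N (P : lstruct ar) (h : M -> N) (g : N -> P) X :
  iso_on h X -> iso_on g (h @` X) -> iso_on (g \o h) X.
Proof.
move=> [injh hrel] [injg grel]; split.
  by move=> x y xX yX /= /injg/injh; apply=> //; apply: in_imfset.
move=> E t tX; rewrite -hrel // -grel.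
  by congr (lrel E _); apply: eq_from_tnth => i; rewrite !tnth_map.
by move=> _ /mapP[x xt ->]; apply: in_imfset; apply: tX.
Qed.

Lemma iso_inv M N (h : M -> N) (X : {fset M}) : M -> iso_on h X ->
  exists h', [/\ iso_on h' (h @` X), h' @` (h @` X) = X & forall x, x \in X -> h' (h x) = x].
Proof.
move=> x0 [injh hrel].
have ex y : exists x, y \in h @` X -> x \in X /\ h x = y.
  have [/imfsetP[x /= xX ->]|_] := boolP (y \in h @` X); last by exists x0.
  by exists x.
have [h' hh'] := choice ex.
have h'h x : x \in X -> h' (h x) = x.
  move=> xX; have [h'X hh'x] := hh' _ (in_imfset imfset_key h xX : h x \in h @` X).
  exact: injh.
exists h'; split=> //; first split.
- by move=> _ _ /imfsetP[x /= xX ->] /imfsetP[y /= yX ->]; rewrite !h'h // => ->.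
- move=> E t tX; rewrite -hrel; last first.
    by move=> _ /mapP[y yt ->]; have [] := hh' _ (tX _ yt).
  congr (lrel E _); apply: eq_from_tnth => i; rewrite !tnth_map.
  by have [_ ->] := hh' _ (tX _ (mem_tnth i t)).
apply/fsetP => x; apply/imfsetP/idP => /= [[_ /imfsetP[y /= yX ->] ->]|xX].
  by rewrite h'h.
by exists (h x); rewrite ?h'h //; apply: in_imfset.
Qed.

Lemma emb_of_iso M N (h : M -> N) (X : {fset M}) :
  iso_on h X -> emb_from (fun x : X => h (val x)).
Proof.
case=> injh hrel; split; first by move=> x y /injh/val_inj; apply; apply: valP.
move=> E t; rewrite -hrel; last by move=> _ /mapP[x _ ->]; apply: valP.
by congr (lrel E _); apply: eq_from_tnth => i; rewrite !tnth_map.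
Qed.

Lemma iso_of_emb M N (X : {fset M}) (f : X -> N) : N -> emb_from f ->
  exists h, iso_on h X /\ forall x : X, h (val x) = f x.
Proof.
move=> y0 [injf frel].
pose h x := if insub x is Some x' then f x' else y0.
have hE (x : X) : h (val x) = f x by rewrite /h valK.
exists h; split=> //; split.
  move=> x y xX yX; rewrite -[x]/(val [` xX]) -[y]/(val [` yX]) !hE => /injf ->.
  by [].
move=> E t tX; have [t' <-] := lift_tuple tX; rewrite frel; congr (lrel E _).
by apply: eq_from_tnth => i; rewrite !tnth_map hE.
Qed.

Definition hg_struct (T : choiceType) (e : L -> {fset T} -> bool) : lstruct ar :=
  LStruct (fun E (t : (ar E).-tuple T) => uniq t && e E [fset x in tval t]).

Lemma hg_inKL (T : choiceType) (e : L -> {fset T} -> bool) (A : {fset hg_struct e}) : inKL A.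
Proof.
move=> E t t'; split=> [/andP[ut _]|tt'].
  by move: ut; rewrite /= map_inj_uniq //; exact: val_inj.
have ptt' : perm_eq (map val t) (map val t') by apply: perm_map.
rewrite /= (perm_uniq ptt'); congr (_ && e E _).
by apply/fsetP => x; rewrite !inE; apply: perm_mem.
Qed.

Lemma edge_hg (T : choiceType) (e : L -> {fset T} -> bool) E (S : {fset T}) :
  uniform ar e -> @edge (hg_struct e) E S = e E S.
Proof.
move=> unie; apply/asboolP/idP => [[t [/andP[_ et] ->]] //|eS].
have sz : size (enum_fset S) == ar E by rewrite (unie _ _ eS).
have SE : S = [fset x in tval (Tuple sz)] by apply/fsetP => x; rewrite inE.
by exists (Tuple sz); split=> //=; rewrite fset_uniq -[X in e E X]SE.
Qed.

End Structures.

(** * Free amalgamation over a finite set *)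

Section Amalgam.
Variables (R : realType) (L : finType) (ar : L -> nat) (alpha : L -> R).
Variable M : lstruct ar.
Hypothesis KM : forall A : {fset M}, inKL A.
Local Notation dla := (dl alpha).
Local Notation dm := (dl alpha (@edge L ar M)).
Local Notation T := (M + nat)%type.

(** The summand [nat] is the supply of fresh points for extensions of subsets of [M]. *)
Definition is_inr (x : T) : bool := if x is inr _ then true else false.

Lemma inr_infinite (Y : {fset T}) : exists2 x, is_inr x & x \notin Y.
Proof.
have [//|no] := pselect (exists2 x, is_inr x & x \notin Y).
suff : ((#|` Y|).+1 <= #|` Y|)%N by rewrite ltnn.
have inj : injective (inr : nat -> T) by move=> ? ? [].
have -> : (#|` Y|).+1 = #|` inr @` [fset i in iota 0 (#|` Y|).+1] : {fset T}|.
  rewrite (card_imfset _ _ inj) -[RHS]/(#|` _|) card_fseq.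
  by rewrite undup_id ?iota_uniq // size_iota.
apply: fsubset_leq_card; apply/fsubsetP => _ /imfsetP[i /= _ ->].
by apply/negPn/negP => iY; apply: no; exists (inr i).
Qed.

Lemma inl_inj : injective (inl : M -> T). Proof. by move=> ? ? []. Qed.

Lemma mem_inl (S : {fset M}) x : ((inl x : T) \in inl @` S) = (x \in S).
Proof. by rewrite mem_imfset //=; apply: inl_inj. Qed.

Lemma card_inl (S : {fset M}) : #|` (inl @` S : {fset T})| = #|` S|.
Proof. by rewrite card_imfset //; apply: inl_inj. Qed.

Lemma inl_sub (S S' : {fset M}) : ((inl @` S : {fset T}) `<=` inl @` S') = (S `<=` S').
Proof.
apply/fsubsetP/fsubsetP => sub x; first by rewrite -!mem_inl => /sub.
by case/imfsetP => y /= /sub yS ->; rewrite mem_inl.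
Qed.

Lemma inl_imfset_inj : injective (fun S : {fset M} => (inl @` S : {fset T})).
Proof. by move=> S S' /fsetP E; apply/fsetP => x; rewrite -!mem_inl E. Qed.

Lemma inl_preimage (C : {fset M}) (X : {fset T}) : X `<=` inl @` C ->
  exists2 A, A `<=` C & X = inl @` A.
Proof.
move=> XC; exists [fset x in C | inl x \in X]; first exact: fset_sub.
apply/fsetP => z; apply/idP/imfsetP => /= [zX|[x]]; last first.
  by rewrite !inE => /andP[_ xX] ->.
have /imfsetP[x /= xC zE] := fsubsetP XC z zX.
by exists x => //; rewrite !inE xC -zE.
Qed.

(** The predicate [Q] selects how much of [M] is kept: a finite set when copies are made inside [M],
    everything when [M] itself is extended. *)
Definition inl_edges (Q : pred M) E (S : {fset T}) : bool :=
  `[< exists S0, [/\ S = inl @` S0, {subset S0 <= Q} & edge E S0] >].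

Lemma inl_edgesE (Q : pred M) E (S : {fset M}) : {subset S <= Q} ->
  inl_edges Q E (inl @` S) = edge E S.
Proof.
move=> SQ; apply/asboolP/idP => [[S0 [/inl_imfset_inj-> //]]|eS].
by exists S.
Qed.

Lemma inl_edges_uniform (Q : pred M) : uniform ar (inl_edges Q).
Proof.
move=> E S /asboolP[S0 [-> _ /(edge_card (@KM S0) (fsubset_refl _)) <-]].
by rewrite card_imfset //; apply: inl_inj.
Qed.

Lemma inl_edges_supported (C : {fset M}) : supported (inl_edges (mem C)) (inl @` C).
Proof. by move=> E S /asboolP[S0 [-> /fsubsetP S0C _]]; rewrite inl_sub. Qed.

Lemma dl_inl (e : L -> {fset T} -> bool) (A : {fset M}) :
  (forall E S, S `<=` A -> e E (inl @` S) = edge E S) -> dla e (inl @` A) = dm A.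
Proof. by move=> eA; apply: dl_transport => // x y _ _; apply: inl_inj. Qed.

Lemma dl_inl_edges (Q : pred M) (A : {fset M}) : {subset A <= Q} ->
  dla (inl_edges Q) (inl @` A) = dm A.
Proof.
by move=> AQ; apply: dl_inl => E S /fsubsetP SA; apply: inl_edgesE => x /SA/AQ.
Qed.

Variables (C : {fset M}) (e1 : L -> {fset T} -> bool) (Y : {fset T}) (Q : pred M).
Hypothesis sup1 : supported e1 Y.
Hypothesis CY : inl @` C `<=` Y.
Hypothesis YC : forall x, x \in Y -> x \notin (inl @` C : {fset T}) -> is_inr x.
Hypothesis e1C : forall E S, S `<=` (inl @` C : {fset T}) -> e1 E S = inl_edges (mem C) E S.

Definition amalg E S := inl_edges Q E S || e1 E S.

Lemma mem_inlY x : (inl x \in Y) = (x \in C).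
Proof.
apply/idP/idP => [xY|xC]; last by apply: (fsubsetP CY); rewrite mem_inl.
by apply/negPn/negP => xC; have := YC xY; rewrite mem_inl => /(_ xC).
Qed.

Lemma amalg_inl E (S : {fset M}) : {subset S <= Q} -> amalg E (inl @` S) = edge E S.
Proof.
move=> SQ; rewrite /amalg inl_edgesE //; case eS: (edge E S) => //=.
apply/negP => e1S; move: (e1S); rewrite e1C; last first.
  rewrite inl_sub; apply/fsubsetP => x xS; rewrite -mem_inlY.
  by apply: (fsubsetP (sup1 e1S)); rewrite mem_inl.
by case/asboolP => S0 [/inl_imfset_inj <- _]; rewrite eS.
Qed.

Lemma amalg_Y E S : S `<=` Y -> amalg E S = e1 E S.
Proof.
move=> SY; rewrite /amalg; case e1S: (e1 E S); rewrite ?orbT // orbF.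
apply/negP => /asboolP[S0 [SE _ eS0]]; move: SY e1S; rewrite SE => SY.
have S0C : S0 `<=` C.
  by apply/fsubsetP => x xS0; rewrite -mem_inlY; apply: (fsubsetP SY); rewrite mem_inl.
by rewrite e1C ?inl_sub // inl_edgesE ?eS0 //; apply/fsubsetP.
Qed.

Lemma amalg_uniform : uniform ar e1 -> uniform ar amalg.
Proof. by move=> uni1 E S /orP[/inl_edges_uniform|/uni1]. Qed.

(** The last hypothesis makes [A] and [Z] agree on the common part, so they meet in the copy of the
    intersection of [A] and [C]; no hyperedge crosses, and [dl_free] applies. *)
Lemma dl_amalg (A : {fset M}) (Z : {fset T}) : {subset A <= Q} -> Z `<=` Y ->
  (forall x, x \in Q -> x \in C -> (x \in A) = (inl x \in Z)) ->
  dla amalg (inl @` A `|` Z) + dm (A `&` C) = dm A + dla e1 Z.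
Proof.
move=> AQ ZY AZ.
have AZI : inl @` A `&` Z = inl @` (A `&` C).
  apply/fsetP => -[x|n]; rewrite inE; last first.
    by apply/idP/idP => [/andP[/imfsetP[]]//|/imfsetP[]].
  rewrite !mem_inl inE; case xA: (x \in A) => //=; apply/idP/idP => [xZ|xC].
    by rewrite -mem_inlY; apply: (fsubsetP ZY).
  by rewrite -AZ //; apply: AQ.
have edlA (A' : {fset M}) : A' `<=` A -> dla amalg (inl @` A') = dm A'.
  move=> /fsubsetP A'A; apply: dl_inl => E S /fsubsetP SA'.
  by apply: amalg_inl => x /SA'/A'A/AQ.
rewrite -(edlA (A `&` C)) ?fsubsetIl // -AZI dl_free ?edlA ?fsubset_refl //.
  by congr (_ + _); apply: eq_dl => E S SZ; apply: amalg_Y; apply: fsubset_trans ZY.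
move=> E S /orP[/asboolP[S0 [-> S0Q _]]|e1S] /fsubsetP SAZ; apply/orP; [left|right].
  rewrite inl_sub; apply/fsubsetP => x xS0; have := SAZ (inl x).
  rewrite mem_inl => /(_ xS0); rewrite inE mem_inl => /orP[//|xZ].
  by rewrite AZ ?S0Q // -mem_inlY; apply: (fsubsetP ZY).
apply/fsubsetP => x xS; have := SAZ x xS; rewrite inE => /orP[|//].
case/imfsetP => y /= yA xE; rewrite xE -AZ // ?AQ //.
by rewrite -mem_inlY -xE; apply: (fsubsetP (sup1 e1S)).
Qed.

End Amalgam.

(** * Closed copies of strong extensions *)

Section Models.
Variables (R : realType) (L : finType) (ar : L -> nat) (alpha : L -> R).
Hypothesis har : forall E, (2 <= ar E)%N.
Hypothesis halpha : forall E, 0 < alpha E <= 1.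
Local Notation dla := (dl alpha).
Local Notation dm := (dl alpha (@edge L ar _)).

Lemma iso_dl (M N : lstruct ar) (h : M -> N) (X Y : {fset M}) :
  iso_on h X -> Y `<=` X -> dm (h @` Y) = dm Y.
Proof.
move=> iso YX; apply: dl_transport.
  by move=> x y /(fsubsetP YX) xX /(fsubsetP YX); apply: iso.1.
by move=> E S SY; apply: iso_edge iso _; apply: fsubset_trans YX.
Qed.

Lemma eq_imfset_in (T T' : choiceType) (f g : T -> T') (A : {fset T}) :
  {in A, f =1 g} -> f @` A = g @` A.
Proof.
move=> fg; apply/fsetP => y; apply/imfsetP/imfsetP => /= -[x xA ->]; exists x => //.
  exact: fg.
by rewrite fg.
Qed.

Lemma imfset_comp (T1 T2 T3 : choiceType) (f : T1 -> T2) (g : T2 -> T3) (A : {fset T1}) :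
  (g \o f) @` A = g @` (f @` A).
Proof.
apply/fsetP => y; apply/imfsetP/imfsetP => /= [[x xA ->]|[_ /imfsetP[x /= xA ->] ->]].
  by exists (f x) => //; apply: in_imfset.
by exists x.
Qed.

Lemma imfset_sub (T1 T2 : choiceType) (f : T1 -> T2) (A B : {fset T1}) :
  A `<=` B -> f @` A `<=` f @` B.
Proof.
move=> /fsubsetP AB; apply/fsubsetP => _ /imfsetP[x /= /AB xB ->].
exact: in_imfset.
Qed.

Lemma model_inKL (M : lstruct ar) (A : {fset M}) : is_model alpha M -> inKL A.
Proof. by case=> /(_ A)[]. Qed.

Lemma model_ge0 (M : lstruct ar) (A : {fset M}) : is_model alpha M -> 0 <= dm A.
Proof. by case=> /(_ A)[_ /(_ A (fsubset_refl _))]; rewrite delta_dl. Qed.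

Lemma hg_dl (T : choiceType) (e : L -> {fset T} -> bool) (X : {fset T}) : uniform ar e ->
  dl alpha (@edge L ar (hg_struct ar e)) X = dla e X.
Proof. by move=> unie; apply: eq_dl => E S _; apply: edge_hg. Qed.

Lemma model_extend (M B : lstruct ar) (X Y : {fset B}) (h : B -> M) :
  is_model alpha M -> M -> inKL Y -> (forall A, A `<=` Y -> 0 <= dm A) -> X `<=` Y ->
  (forall A, X `<=` A -> A `<=` Y -> dm X <= dm A) -> iso_on h X ->
  exists g, iso_on g Y /\ {in X, g =1 h}.
Proof.
move=> [_ ext] y0 KY Y0 XY strong iso.
have KaY : inKalpha alpha Y by split=> // A AY; rewrite delta_dl Y0.
have leXY : leS alpha X Y by split=> // A XA AY; rewrite !delta_dl strong.
have [f [embf fh]] := ext B X Y KaY leXY _ (emb_of_iso iso).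
have [g [isog gf]] := iso_of_emb y0 embf; exists g; split=> // x xX.
by rewrite -[x]/(val [` fsubsetP XY x xX]) gf (fh [` xX]).
Qed.

(** A single isolated point is a strong extension of the empty structure. The element serves as a
    default value for total maps. *)
Lemma model_inhabited (M : lstruct ar) : is_model alpha M -> exists x : M, True.
Proof.
case=> _ ext; pose B := hg_struct ar (fun (E : L) (S : {fset nat}) => false).
have dmE (X : {fset B}) : delta alpha X = (#|` X|)%:R.
  rewrite delta_dl hg_dl // /dl big1 ?subr0 // => E _.
  suff -> : cnt (fun (E : L) (S : {fset nat}) => false) E X = 0%N by rewrite mulr0.
  by apply/eqP; rewrite cardfs_eq0; apply/eqP/fsetP => S; rewrite !inE /= andbF.
pose Y : {fset B} := [fset 0%N].
have KaY : inKalpha alpha Y by split; [exact: hg_inKL|move=> A _; rewrite dmE].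
have le0Y : leS alpha fset0 Y.
  by split=> // A _ _; rewrite !dmE cardfs0.
have no (x : (fset0 : {fset B})) : False by have := valP x; rewrite inE.
pose f (x : (fset0 : {fset B})) : M := match no x with end.
have embf : emb_from f.
  split=> [x|E t]; first by case: (no x).
  by case: (no (tnth t (Ordinal (leq_trans (isT : (0 < 2)%N) (har E))))).
have [g _] := ext B fset0 Y KaY le0Y f embf.
by exists (g [` fset11 (0%N : B)]).
Qed.

Hypothesis hnot : ~ (forall E : L, ar E = 2%N /\ alpha E = 1).
Variable M : lstruct ar.
Hypothesis hM : is_model alpha M.
Local Notation edgeM := (@edge L ar M).

(* The copy of [C] is taken inside a copy over [h @` K] of the free amalgam of [K]
   with an extension [Y] of [C] of predimension less than [eps] over [K `&` C]: a small
   extension of the copy with negative relative predimension would, added to that of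
   [Y], make the predimension drop below that of [h @` K]. *)
Lemma closed_extension k s : exists k1, forall (K C : {fset M}) (h : M -> M),
  iso_on h K -> kclosed alpha edgeM k1 (h @` K) -> (#|` C| <= s)%N ->
  (forall X, K `&` C `<=` X -> X `<=` C -> dm (K `&` C) <= dm X) ->
  (forall X, K `&` C `<=` X -> X `<=` K -> (#|` X `\` (K `&` C)| <= k)%N ->
     dm (K `&` C) <= dm X) ->
  exists g, [/\ iso_on g C, {in K `&` C, g =1 h} & kclosed alpha edgeM k (g @` C)].
Proof.
have KM (A : {fset M}) : inKL A by apply: model_inKL.
have [x0 _] := model_inhabited hM.
have [eps eps0 gap] := dl_gap halpha k.
have [m ext] := small_extension har halpha (@inr_infinite L ar M) hnot k s eps0.
(* [m] pays for the copy of [Y], and [k] for the small extension refuted at the end. *)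
exists (m + k)%N => K C h isoh clK cC strong closeC0.
set C0 := K `&` C in strong closeC0 *.
have C0C : C0 `<=` C by apply: fsubsetIr.
have C0K : C0 `<=` K by apply: fsubsetIl.
pose e0 := inl_edges (mem C).
have dl0 (A : {fset M}) : A `<=` C -> dla e0 (inl @` A) = dm A.
  by move=> /fsubsetP AC; apply: dl_inl_edges.
have [||||||e1 [Y [uni1 sup1 CY freY [agr cY smallY strongY closeY]]]] :=
  ext e0 (inl @` C0) (inl @` C).
- exact: inl_edges_uniform.
- exact: inl_edges_supported.
- by rewrite inl_sub.
- by rewrite card_inl.
- by rewrite dl0 // model_ge0.
- move=> X C0X /inl_preimage[A AC XE]; move: C0X; rewrite XE inl_sub !dl0 // => C0A.
  exact: strong.
rewrite !dl0 // in smallY strongY closeY.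
pose e2 := amalg e1 (mem K).
have uni2 : uniform ar e2 by apply: amalg_uniform.
pose Yb : {fset M + nat} := inl @` K `|` Y.
have amE (A : {fset M}) (Z : {fset M + nat}) : A `<=` K -> Z `<=` Y ->
    (forall x, x \in K -> x \in C -> (x \in A) = (inl x \in Z)) ->
    dla e2 (inl @` A `|` Z) + dm (A `&` C) = dm A + dla e1 Z.
  by move=> /fsubsetP AK ZY AZ; exact: (dl_amalg _ sup1 CY freY agr AK ZY AZ).
have inY := mem_inlY CY freY.
have split_Yb (X : {fset M + nat}) : X `<=` Yb -> exists A, [/\ A `<=` K,
    (forall x, (x \in A) = (x \in K) && (inl x \in X)),
    X = inl @` A `|` (X `&` Y) & dla e2 X + dm (A `&` C) = dm A + dla e1 (X `&` Y)].
  move=> XYb; exists [fset x in K | inl x \in X].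
  have AE x : (x \in [fset x in K | inl x \in X]) = (x \in K) && (inl x \in X).
    by rewrite !inE.
  have XE : X = inl @` [fset x in K | inl x \in X] `|` (X `&` Y).
    apply/fsetP => -[x|n]; rewrite !inE; last first.
      case nX: (inr n \in X); last by rewrite orbF; apply/esym/negP => /imfsetP[].
      have := fsubsetP XYb _ nX; rewrite !inE => /orP[/imfsetP[]//|->].
      by rewrite orbT.
    rewrite mem_inl !inE; case xX: (inl x \in X); rewrite ?andbF // andbT.
    by have := fsubsetP XYb _ xX; rewrite !inE mem_inl.
  split=> //; first exact: fset_sub.
  rewrite {1}XE amE ?fset_sub ?fsubsetIr // => x xK xC.
  by rewrite AE xK !inE inY xC andbT.
have C0Y X : inl @` C0 `<=` X -> X `<=` Y -> dm C0 <= dla e1 X by apply: strongY.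
(* Submodularity with [C0], which is strong in [Y], shows that the part of [X] in [Y] has at least
   the predimension of its trace on [C0]; the value is thus at least that of the part of [X] in
   [K]. *)
have ge2 X : X `<=` Yb -> 0 <= dla e2 X.
  move=> /split_Yb[A [AK AE XE E]].
  have := dlUI halpha e1 (X `&` Y) (inl @` C0).
  have := C0Y _ (fsubsetUr (X `&` Y) (inl @` C0)).
  rewrite fsubUset fsubsetIr (fsubset_trans _ CY) ?inl_sub // => /(_ isT).
  have -> : dla e1 (inl @` C0) = dm C0.
    rewrite -dl0 //; apply: eq_dl => E' S SC; apply: agr.
    by apply: fsubset_trans SC _; rewrite inl_sub.
  have -> : (X `&` Y) `&` inl @` C0 = inl @` (A `&` C).
    apply/fsetP => -[x|n]; rewrite !inE ?mem_inl ?inE ?inY ?AE.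
      by case: (x \in K); case: (x \in C); rewrite ?andbT ?andbF.
    by apply/idP/idP => [/andP[_ /imfsetP[]]|/imfsetP[]].
  have -> : dla e1 (inl @` (A `&` C)) = dm (A `&` C).
    rewrite -dl0 ?fsubsetIr //; apply: eq_dl => E' S SC; apply: agr.
    by apply: fsubset_trans SC _; rewrite inl_sub fsubsetIr.
  have := model_ge0 A hM; lra.
have dlYb X : inl @` K `<=` X -> X `<=` Yb -> dla e2 X = dm K - dm C0 + dla e1 (X `&` Y).
  move=> KX /split_Yb[A [AK AE XE E]].
  have AK' : A = K.
    apply/fsetP => x; rewrite AE; case xK: (x \in K) => //=.
    by apply: (fsubsetP KX); rewrite mem_inl.
  by move: E; rewrite AK' -/C0; lra.
have KYb : inl @` K `<=` Yb by apply: fsubsetUl.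
have dlK : dla e2 (inl @` K) = dm K.
  rewrite dlYb ?fsubset_refl //.
  have -> : (inl @` K) `&` Y = inl @` C0.
    apply/fsetP => -[x|n]; rewrite !inE ?mem_inl ?inE ?inY //.
    by apply/idP/idP => [/andP[/imfsetP[]]|/imfsetP[]].
  suff -> : dla e1 (inl @` C0) = dm C0 by ring.
  rewrite -dl0 //; apply: eq_dl => E' S SC; apply: agr.
  by apply: fsubset_trans SC _; rewrite inl_sub.
pose B := hg_struct ar e2.
have inl_iso : iso_on (inl : M -> B) K.
  apply: iso_of_edge => //; first exact: hg_inKL.
    by move=> x y _ _; apply: inl_inj.
  move=> E S /fsubsetP SK; rewrite edge_hg //.
  by apply: (amalg_inl sup1 CY freY agr).
have [inv_inl [iso_inv _ invK]] := iso_inv x0 inl_iso.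
have isoX : iso_on (h \o inv_inl : B -> M) (inl @` K).
  apply: iso_comp iso_inv _; apply: iso_sub isoh.
  by apply/fsubsetP => _ /imfsetP[_ /= /imfsetP[x /= xK ->] ->]; rewrite invK.
(* [K] is strong in the amalgam because [C0] is strong in [Y], so the given copy of [K] extends to
   the whole amalgam. *)
have [G [isoG GK]] : exists G : B -> M, iso_on G Yb /\ {in (inl @` K : {fset B}), G =1 h \o inv_inl}.
  apply: model_extend => //; first exact: hg_inKL.
    by move=> A /ge2; rewrite hg_dl.
  move=> A KA AY; rewrite !hg_dl // dlK dlYb //.
  have := C0Y (A `&` Y) _ (fsubsetIr _ _); rewrite fsubsetI (fsubset_trans _ KA) ?inl_sub //.
  by rewrite (fsubset_trans _ CY) ?inl_sub // => /(_ isT); lra.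
have CYb : inl @` C `<=` Yb by apply: fsubset_trans CY (fsubsetUr _ _).
have iso_inlC : iso_on (inl : M -> B) C.
  apply: iso_of_edge => //; first exact: hg_inKL.
    by move=> x y _ _; apply: inl_inj.
  move=> E S SC; rewrite edge_hg // /e2 (amalg_Y _ CY freY agr); last first.
    by apply: fsubset_trans CY; rewrite inl_sub.
  by rewrite agr ?inl_sub // /e0 inl_edgesE //; apply/fsubsetP.
pose g x := G (inl x).
have gE (S : {fset M}) : g @` S = G @` (inl @` S) by rewrite -imfset_comp.
have GKE : G @` (inl @` K) = h @` K.
  rewrite -imfset_comp; apply: eq_imfset_in => x xK /=.
  by rewrite GK /= ?invK //; apply: in_imfset.
have dmG Z : Z `<=` Yb -> dm (G @` Z) = dla e2 Z.
  by move=> ZYb; rewrite (iso_dl isoG ZYb) hg_dl.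
have isog : iso_on g C.
  apply: (iso_comp iso_inlC); apply: iso_sub isoG; exact: CYb.
exists g; split=> //.
- move=> x; rewrite inE => /andP[xK _]; rewrite /g GK ?invK //=; last exact: in_imfset.
  by rewrite invK.
move=> Y' gCY' cY'; rewrite leNgt; apply/negP => lt.
pose Z := [fset z in Yb | G z \in Y'].
have ZE z : (z \in Z) = (z \in Yb) && (G z \in Y') by rewrite !inE.
have ZYb : Z `<=` Yb by apply: fset_sub.
have CZ : inl @` C `<=` Z.
  apply/fsubsetP => z zC; rewrite ZE (fsubsetP CYb) //=.
  by apply: (fsubsetP gCY'); rewrite gE; apply: in_imfset.
have GZ : Y' `&` (G @` Yb) = G @` Z.
  apply/fsetP => y; rewrite inE; apply/andP/imfsetP => /= [[yY' /imfsetP[z /= zYb yE]]|[z]].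
    by exists z; rewrite // ZE zYb -yE.
  by rewrite ZE => /andP[zYb zY'] ->; split=> //; apply: in_imfset.
have cZ : (#|` Z `\` inl @` C| <= k)%N.
  have <- : #|` G @` (Z `\` inl @` C)| = #|` Z `\` inl @` C|.
    rewrite card_in_imfset // => x y /= xZ yZ; apply: isoG.1; apply: (fsubsetP ZYb).
      by move: xZ; rewrite inE => /andP[].
    by move: yZ; rewrite inE => /andP[].
  apply: leq_trans cY'; apply: fsubset_leq_card; apply/fsubsetP => _ /imfsetP[z /= + ->].
  move=> /fsetDP[zZ zC]; move: (zZ); rewrite ZE => /andP[zYb zY'].
  rewrite inE zY' andbT gE; apply: contra zC => /imfsetP[z' /= z'C].
  by move=> /isoG.1 -> //; apply: (fsubsetP CYb).
(* The trace [Z] of the small extension splits into a part in [K], controlled by [closeC0], and a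
   part in [Y], controlled by [closeY]. *)
have geC : dm C <= dla e2 Z.
  have [A [AK AE ZE' E]] := split_Yb Z ZYb.
  have AC : A `&` C = C0.
    apply/fsetP => x; rewrite !inE AE; case xK: (x \in K) => //=.
    case xC: (x \in C); rewrite ?andbF // andbT.
    by apply: (fsubsetP CZ); rewrite mem_inl.
  rewrite AC in E.
  have leA : dm C0 <= dm A.
    apply: closeC0 => //; first by rewrite -AC fsubsetIl.
    apply: leq_trans cZ; rewrite -card_inl.
    apply: fsubset_leq_card; apply/fsubsetP => _ /imfsetP[x /= + ->].
    move=> /fsetDP[]; rewrite AE => /andP[xK xZ] xC0.
    by apply/fsetDP; split; rewrite // mem_inl; apply: contra xC0; rewrite /C0 inE xK.
  have leY : dm C <= dla e1 (Z `&` Y).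
    apply: closeY; rewrite ?fsubsetIr //; first by rewrite fsubsetI CZ.
    by apply: leq_trans cZ; apply: fsubset_leq_card; apply: fsetSD; apply: fsubsetIl.
  by lra.
have dgC : dm (g @` C) = dm C by rewrite (iso_dl isog (fsubset_refl _)).
have GZY' : G @` Z `<=` Y' by rewrite -GZ fsubsetIl.
have gCGZ : g @` C `<=` G @` Z by rewrite gE; apply: imfset_sub.
(* The drop therefore occurs over the trace, outside the copy of the amalgam, and the gap makes it
   at least [eps]. *)
have : dm Y' <= dm (G @` Z) - eps.
  apply: gap => //; last by rewrite dmG //; apply: lt_le_trans geC; rewrite -dgC.
  by apply: leq_trans cY'; apply: fsubset_leq_card; apply: fsetDS.
(* Joining [Y'] to the copy of the amalgam gives predimension at most
   [dm K - dm C0 + dla e1 Y - eps], which is below [dm K], while only [m + k] points were added to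
   the image of [K]. *)
have := dlUI halpha edgeM Y' (G @` Yb); rewrite GZ dmG // (dmG Yb) ?fsubset_refl //.
rewrite (dlYb Yb) ?fsubset_refl //; have -> : Yb `&` Y = Y by rewrite /Yb fsetUK.
have : dm (h @` K) <= dm (Y' `|` G @` Yb).
  apply: clK; first by rewrite -GKE (fsubset_trans (imfset_sub G KYb)) ?fsubsetUr.
  apply: (@leq_trans #|` (G @` Y) `|` (Y' `\` g @` C)|).
    apply: fsubset_leq_card; apply/fsubsetP => y; rewrite !inE => /andP[yK].
    have [yY|yY] := boolP (y \in G @` Y) => //= /orP[yY'|/imfsetP[z /= zYb yE]].
      rewrite yY' andbT; apply: contra yY; rewrite gE; apply: (fsubsetP (imfset_sub _ CY)).
    move: zYb; rewrite inE => /orP[zK|zY].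
      by case/negP: yK; rewrite -GKE yE; apply: in_imfset.
    by case/negP: yY; rewrite yE; apply: in_imfset.
  apply: leq_trans (leq_card_fsetU _ _) _; apply: leq_add => //.
  by apply: leq_trans cY; apply: leq_imfset_card.
rewrite (iso_dl isoh (fsubset_refl _)).
by move: smallY; lra.
Qed.

End Models.

(** * Formulas and closed sets *)

Section BackForth.
Variables (R : realType) (L : finType) (ar : L -> nat) (alpha : L -> R).
Hypothesis har : forall E, (2 <= ar E)%N.
Hypothesis halpha : forall E, 0 < alpha E <= 1.
Hypothesis hnot : ~ (forall E : L, ar E = 2%N /\ alpha E = 1).
Variable M : lstruct ar.
Hypothesis hM : is_model alpha M.
Local Notation edgeM := (@edge L ar M).
Local Notation dm := (dl alpha edgeM).
Local Notation kcl := (kclosed alpha edgeM).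

Lemma fv_bound (phi : formula ar) : exists n, fv_below n phi.
Proof.
elim: phi => [x y|E t|p [n fvn]|p [n fvn] q [m fvm]|y p [n fvn]] /=.
- by exists (maxn x y).+1 => z /= /orP[]/eqP->; rewrite ltnS leq_max leqnn ?orbT.
- exists (\max_(x <- t) x).+1 => z /= zt; rewrite ltnS.
  exact: (leq_bigmax_seq (F := id)).
- by exists n.
- exists (maxn n m) => z /= /orP[/fvn|/fvm] lt; rewrite leq_max lt ?orbT //.
by exists n => z /= /andP[_ /fvn].
Qed.

(* In the existential case only the closure [C] of the parameters and the witness is
   carried over, not [K]: its size is bounded independently of [k1]. *)
Lemma back_and_forth (phi : formula ar) : exists k, forall (K : {fset M}) (h : M -> M) v v',
  iso_on h K -> kcl k K -> kcl k (h @` K) ->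
  (forall x, Defs.free x phi -> v x \in K /\ v' x = h (v x)) -> (sat v phi <-> sat v' phi).
Proof.
elim: phi => [x y|E t|p [k IH]|p [k1 IH1] q [k2 IH2]|x p [k IH]].
- exists 0 => K h v v' [injh _] _ _ fv /=.
  have [|vx ->] := fv x; first by rewrite /= eqxx.
  have [|vy ->] := fv y; first by rewrite /= eqxx orbT.
  by split=> [->//|]; apply: injh.
- exists 0 => K h v v' [_ hrel] _ _ fv /=.
  have -> : map_tuple v' t = map_tuple h (map_tuple v t).
    apply: eq_from_tnth => i; rewrite !tnth_map.
    by have [|_ ->] := fv (tnth t i); rewrite //= mem_tnth.
  by rewrite hrel // => _ /mapP[x xt ->]; have [] := fv x.
- by exists k => K h v v' iso clK clhK fv /=; rewrite (IH K h v v').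
- exists (maxn k1 k2) => K h v v' iso clK clhK fv /=.
  rewrite (IH1 K h v v') // ?(IH2 K h v v') //.
  + by apply: kclosed_le clK; apply: leq_maxr.
  + by apply: kclosed_le clhK; apply: leq_maxr.
  + by move=> x fx; apply: fv; rewrite /= fx orbT.
  + by apply: kclosed_le clK; apply: leq_maxl.
  + by apply: kclosed_le clhK; apply: leq_maxl.
  by move=> x fx; apply: fv; rewrite /= fx.
have [n fvn] := fv_bound (F_ex x p).
have [s closure] := kclosure halpha k n.+1.
have [k1 ext] := closed_extension har halpha hnot hM k s.
(* [closed_extension] asks for a [k1]-closed image of [K]; as [C] has at most [s] points,
   [s]-closedness of [K] makes the intersection of [K] and [C] strong in [C]. *)
exists (maxn k1 (maxn s k)).
suff half (K : {fset M}) (h : M -> M) v v' : iso_on h K -> kcl (maxn k1 (maxn s k)) K ->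
    kcl (maxn k1 (maxn s k)) (h @` K) ->
    (forall y, Defs.free y (F_ex x p) -> v y \in K /\ v' y = h (v y)) ->
    sat v (F_ex x p) -> sat v' (F_ex x p).
  move=> K h v v' iso clK clhK fv; split; first exact: half iso clK clhK fv.
  have [x0 _] := model_inhabited har hM.
  have [h' [iso' h'hK h'h]] := iso_inv x0 iso.
  apply: (half (h @` K) h') => //; first by rewrite h'hK.
  by move=> y /fv[vK ->]; rewrite h'h //; split=> //; apply: in_imfset.
move=> iso clK clhK fv [a sa].
have [clK1 clKs clKk] : [/\ kcl k1 (h @` K), kcl s K & kcl k K].
  split; [apply: kclosed_le clhK|apply: kclosed_le clK|apply: kclosed_le clK].
  - exact: leq_maxl.
  - by rewrite !leq_max leqnn orbT.
  by rewrite !leq_max leqnn !orbT.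
pose A := a |` [fset v y | y in [seq y <- iota 0 n | Defs.free y (F_ex x p)]].
have cA : (#|` A| <= n.+1)%N.
  rewrite cardfsU1 -add1n leq_add ?leq_b1 //.
  apply: leq_trans (leq_imfset_card _ _ _) _.
  apply: leq_trans (size_undup _) _; rewrite size_filter.
  by apply: leq_trans (count_size _ _) _; rewrite size_iota.
have [C [AC clC cC]] := closure _ edgeM A (fun X => model_ge0 X hM) cA.
have C0C : K `&` C `<=` C by apply: fsubsetIr.
have [g [isog gh clgC]] : exists g, [/\ iso_on g C, {in K `&` C, g =1 h} & kcl k (g @` C)].
  apply: ext => // X C0X; last first.
    move=> XK cX; have XC : X `&` C = K `&` C.
      by apply/eqP; rewrite eqEfsubset fsetSI //= fsubsetI C0X C0C.
    (* [X] adds to the intersection exactly the points it adds to [C], so [k]-closedness of [C]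
       descends by submodularity. *)
    have : dm C <= dm (X `|` C).
      apply: clC; first exact: fsubsetUr.
      apply: leq_trans cX; apply: fsubset_leq_card; rewrite -XC.
      by apply/fsubsetP => y; rewrite !inE; case: (y \in C); rewrite ?andbF ?orbF ?andbT.
    by have := dlUI halpha edgeM X C; rewrite XC; lra.
  move=> XC; have XK : X `&` K = K `&` C.
    apply/eqP; rewrite eqEfsubset; apply/andP; split; first by rewrite fsetIC fsetIS.
    by rewrite fsubsetI C0X fsubsetIl.
  have : dm K <= dm (X `|` K).
    apply: clKs; first exact: fsubsetUr.
    apply: leq_trans cC; apply: fsubset_leq_card; apply/fsubsetP => y; rewrite !inE.
    by case/andP=> /negPf ->; rewrite orbF; apply: (fsubsetP XC).
  by have := dlUI halpha edgeM X K; rewrite XK; lra.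
exists (g a); apply: (proj1 (IH C g (upd v x a) _ isog clC clgC _) sa) => y fy; rewrite /upd.
have [_|yx] := eqVneq y x; first by split=> //; apply: (fsubsetP AC); rewrite !inE eqxx.
have fy' : Defs.free y (F_ex x p) by rewrite /= yx.
have [vK ->] := fv y fy'; have vC : v y \in C.
  apply: (fsubsetP AC); rewrite inE; apply/orP; right; apply: in_imfset.
  have : y \in [seq y <- iota 0 n | Defs.free y (F_ex x p)].
    by rewrite mem_filter fy' mem_iota add0n fvn.
  by [].
by rewrite gh // inE vK.
Qed.

End BackForth.

(** * Diagrams of finite sets as formulas *)

Section Diagram.
Variables (L : finType) (ar : L -> nat).
Implicit Types M N : lstruct ar.

(** The empty conjunction is [F_eq 0 0], which has variable 0 free; hence the condition [0 < n] on
    free variables. *)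
Definition conj_over (I : Type) (f : I -> formula ar) (s : seq I) : formula ar :=
  foldr (fun i p => F_and (f i) p) (F_eq ar 0 0) s.

Lemma sat_conj_over (I : eqType) (f : I -> formula ar) (s : seq I) M (v : nat -> M) :
  sat v (conj_over f s) <-> forall i, i \in s -> sat v (f i).
Proof.
elim: s => [|i s IH] /=; first by split.
rewrite IH; split=> [[fi fs] j|fs].
  by rewrite inE => /orP[/eqP->//|/fs].
by split=> [|j js]; apply: fs; rewrite inE ?eqxx ?js ?orbT.
Qed.

Lemma qfree_conj_over (I : Type) (f : I -> formula ar) s :
  (forall i, qfree (f i)) -> qfree (conj_over f s).
Proof. by move=> qf; elim: s => //= i s ->; rewrite qf. Qed.

Lemma fv_conj_over (I : Type) (f : I -> formula ar) s n : (0 < n)%N ->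
  (forall i, fv_below n (f i)) -> fv_below n (conj_over f s).
Proof.
move=> n0 fvf; elim: s => [x /=|i s IH x /= /orP[/fvf|/IH]//].
by rewrite orbb => /eqP->.
Qed.

Definition literal (b : bool) (p : formula ar) := if b then p else F_not p.

Lemma sat_literal b p M (v : nat -> M) : sat v (literal b p) <-> (sat v p <-> b).
Proof. by case: b => /=; split=> // [[]]; auto. Qed.

Definition diag N (u : nat -> N) m : formula ar :=
  F_and
    (conj_over (fun p : 'I_m * 'I_m => literal (u p.1 == u p.2) (F_eq ar p.1 p.2))
       (enum {: 'I_m * 'I_m}))
    (conj_over (fun z : {E : L & (ar E).-tuple 'I_m} =>
         literal (lrel (tag z) (map_tuple (fun i : 'I_m => u i) (tagged z)))
           (F_rel (map_tuple (@nat_of_ord m) (tagged z))))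
       (enum {: {E : L & (ar E).-tuple 'I_m}})).

Lemma qfree_diag N (u : nat -> N) m : qfree (diag u m).
Proof.
by rewrite /= !qfree_conj_over // => [z|p]; rewrite /literal; case: ifP.
Qed.

Lemma fv_diag N (u : nat -> N) m : (0 < m)%N -> fv_below m (diag u m).
Proof.
move=> m0 x /= /orP[]; apply: fv_conj_over => //.
  by move=> [i j] y; rewrite /literal; case: ifP => _ /= /orP[]/eqP->.
by move=> [E t] y; rewrite /literal; case: ifP => _ /= /mapP[i _ ->].
Qed.

Lemma sat_diag N (u : nat -> N) m M (w : nat -> M) : sat w (diag u m) <->
  (forall i j : 'I_m, w i = w j <-> u i = u j) /\
  (forall E (t : (ar E).-tuple 'I_m),
     lrel E (map_tuple (fun i : 'I_m => w i) t) = lrel E (map_tuple (fun i : 'I_m => u i) t)).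
Proof.
have comp E (t : (ar E).-tuple 'I_m) :
    map_tuple w (map_tuple (@nat_of_ord m) t) = map_tuple (fun i : 'I_m => w i) t.
  by apply: eq_from_tnth => i; rewrite !tnth_map.
rewrite /= !sat_conj_over; split=> -[h1 h2]; split.
- move=> i j; have := h1 (i, j); rewrite mem_enum => /(_ isT)/sat_literal /= ->.
  by split=> [/eqP|->].
- move=> E t; have := h2 (Tagged _ t); rewrite mem_enum => /(_ isT)/sat_literal /=.
  by rewrite comp => rw; apply/idP/idP => /rw.
- by move=> [i j] _; apply/sat_literal => /=; rewrite h1; split=> [->|/eqP].
by move=> [E t] _; apply/sat_literal => /=; rewrite comp h2.
Qed.

Lemma sat_exs ys (phi : formula ar) M (v : nat -> M) :
  sat v (exs ys phi) <-> exists u, (forall x, x \notin ys -> u x = v x) /\ sat u phi.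
Proof.
elim: ys v => [|y ys IH] v /=.
  split=> [s|[u [uv s]]]; first by exists v.
  by have -> : v = u by apply/funext => x; rewrite uv.
split=> [[a /IH[u [uv s]]]|[u [uv s]]].
  exists u; split=> // x; rewrite inE negb_or => /andP[xy xys].
  by rewrite uv // /upd (negPf xy).
exists (u y); apply/IH; exists u; split=> // x xys; rewrite /upd.
by have [->//|xy] := eqVneq x y; rewrite uv // inE negb_or xy.
Qed.

Lemma free_exs x ys (phi : formula ar) :
  Defs.free x (exs ys phi) = (x \notin ys) && Defs.free x phi.
Proof. by elim: ys => //= y ys ->; rewrite inE negb_or andbA. Qed.

Lemma diag_iso N (u : nat -> N) m M (w : nat -> M) (X : {fset N}) :
  (forall x, x \in X -> exists2 i, (i < m)%N & x = u i) ->
  sat w (diag u m) -> exists h, iso_on h X /\ forall i, (i < m)%N -> h (u i) = w i.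
Proof.
move=> Xu /sat_diag[weq wrel].
have ex x : exists a : M, forall i, (i < m)%N -> x = u i -> a = w i.
  have [[i im ->]|no] := pselect (exists2 i, (i < m)%N & x = u i).
    by exists (w i) => j jm uij; apply/(weq (Ordinal im) (Ordinal jm)).
  by exists (w 0%N) => i im xi; case: no; exists i.
have [h hh] := choice ex.
have hu i : (i < m)%N -> h (u i) = w i by move=> im; apply: hh.
exists h; split=> //; split.
  move=> _ _ /Xu[i im ->] /Xu[j jm ->]; rewrite !hu // => wij.
  exact/(weq (Ordinal im) (Ordinal jm)).
move=> E t tX; have ht i : exists j : 'I_m, tnth t i = u j.
  by have [j jm ->] := Xu _ (tX _ (mem_tnth i t)); exists (Ordinal jm).
have [j jE] := choice ht.
have -> : t = map_tuple (fun i : 'I_m => u i) [tuple j i | i < ar E].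
  by apply: eq_from_tnth => i; rewrite tnth_map tnth_mktuple jE.
rewrite -wrel; congr (lrel E _); apply: eq_from_tnth => i.
by rewrite !tnth_map hu.
Qed.

Lemma iso_diag N (u : nat -> N) m M (h : N -> M) (X : {fset N}) :
  (forall i, (i < m)%N -> u i \in X) -> iso_on h X -> sat (h \o u) (diag u m).
Proof.
move=> uX [injh hrel]; apply/sat_diag; split.
  by move=> i j /=; split=> [/injh|->//]; apply; apply: uX.
move=> E t; rewrite -hrel; last by move=> _ /mapP[i _ ->]; apply: uX.
by congr (lrel E _); apply: eq_from_tnth => i; rewrite !tnth_map.
Qed.

(** Variables below [n] name the parameters and the next [b] ones enumerate all of [B]. Quantifying
    the latter in the joint diagram says that the parameters lie in a copy of [B]. *)
Lemma fset_diag N n (v : nat -> N) (B : {fset N}) : (0 < #|` B|)%N ->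
  (forall i, (i < n)%N -> v i \in B) ->
  exists ys phi, [/\ qfree phi, fv_below n (exs ys phi) &
    forall M (w : nat -> M), sat w (exs ys phi) <->
      exists h : N -> M, iso_on h B /\ forall i, (i < n)%N -> h (v i) = w i].
Proof.
move=> B0 vB; pose b := #|` B|; pose m := (n + b)%N.
pose u i := if (i < n)%N then v i else nth (v 0%N) (enum_fset B) (i - n).
have uB i : (i < m)%N -> u i \in B.
  rewrite /u /m; case: (ltnP i n) => [/vB//|ni im]; apply: mem_nth.
  by rewrite -/b; lia.
have Bu x : x \in B -> exists2 i, (i < m)%N & x = u i.
  move=> xB; exists (n + index x (enum_fset B))%N; first by rewrite ltn_add2l index_mem.
  by rewrite /u ltnNge leq_addr /= addKn nth_index.
exists (iota n b), (diag u m); split; first exact: qfree_diag.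
  move=> x; rewrite free_exs mem_iota => /andP[+ /(fv_diag _)].
  rewrite -/m => + /(_ (leq_trans B0 (leq_addl n b))) xm.
  by rewrite xm andbT -ltnNge.
move=> M w; rewrite sat_exs; split=> [[w' [w'w /(diag_iso Bu)[h [isoh hu]]]]|[h [isoh hv]]].
  exists h; split=> // i ni; have := hu i; rewrite /u ni => -> //; last exact: ltn_addr.
  by apply: w'w; rewrite mem_iota leqNgt ni.
exists (fun i => if (i < m)%N then h (u i) else w i); split.
  move=> x; case: ifP => // xm; rewrite mem_iota negb_and -ltnNge -/m xm orbF => xn.
  by rewrite /u xn hv.
have [eqs rels] := iffLR (sat_diag _ _ _) (iso_diag uB isoh).
by apply/sat_diag; split=> [i j|E t]; rewrite -?eqs -?rels ?ltn_ord //=; congr (lrel E _);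
  apply: eq_from_tnth => i; rewrite !tnth_map ltn_ord.
Qed.

End Diagram.

(** * Embedding a structure in a model *)

(* [New c ps k] is the [k]-th point of the copy of the coded extension [c] that is
   freely adjoined over the parameters [ps]; indices below [size ps] stand for the
   parameters themselves. *)
Inductive tm (L T : Type) : Type :=
  | Base of T
  | New of seq (L * {fset nat}) & seq (tm L T) & nat.
Arguments Base {L T}.

HB.instance Definition _ (L : finType) (T : choiceType) := gen_eqMixin (tm L T).
HB.instance Definition _ (L : finType) (T : choiceType) := gen_choiceMixin (tm L T).

Section TermModel.
Variables (R : realType) (L : finType) (ar : L -> nat) (alpha : L -> R).
Hypothesis har : forall E, (2 <= ar E)%N.
Hypothesis halpha : forall E, 0 < alpha E <= 1.
Variables (T : choiceType) (e : L -> {fset T} -> bool).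
Hypothesis uni : uniform ar e.
Hypothesis ge0 : forall X, 0 <= dl alpha e X.
Local Notation term := (tm L T).
Local Notation code := (seq (L * {fset nat})).

Fixpoint height (t : term) : nat :=
  match t with
  | Base _ => 0
  | New _ ps _ => (foldr maxn 0 (map height ps)).+1
  end.

Arguments height : simpl never.

Lemma height_param c (ps : seq term) k p : p \in ps -> (height p < height (New c ps k))%N.
Proof.
rewrite /height -/height ltnS; elim: ps => //= q ps IH; rewrite inE => /orP[/eqP->|/IH pps].
  exact: leq_maxl.
by rewrite leq_max pps orbT.
Qed.

Definition el c (ps : seq term) i : term :=
  if (i < size ps)%N then nth (New c ps 0) ps i else New c ps i.

Lemma el_inj c ps : uniq ps -> injective (el c ps).
Proof.
have no i j : (i < size ps)%N -> nth (New c ps 0) ps i <> New c ps j.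
  move=> ips E; have := height_param c j (mem_nth (New c ps 0) ips).
  by rewrite E ltnn.
move=> ups i j; rewrite /el; case: ltnP => ips; case: ltnP => jps.
- by move=> /eqP; rewrite nth_uniq // => /eqP.
- by move=> E; case: (no _ _ ips E).
- by move=> E; case: (no _ _ jps (esym E)).
by case.
Qed.

Definition below n : {fset nat} := [fset i in iota 0 n].

Lemma mem_below n i : (i \in below n) = (i < n)%N.
Proof. by rewrite /below inE /= mem_iota. Qed.

Definition weight (c : code) n E (Z : {fset nat}) : nat :=
  #|` [fset l in fpowerset (below n `|` Z) | ((E, l) \in c) && ~~ (l `<=` below n)]|.

(* [c] codes a strong extension of any structure on the [size ps] parameters:
   only the hyperedges containing a new point matter for this. *)
Definition good (c : code) (ps : seq term) :=
  [/\ uniq ps, forall E l, (E, l) \in c -> #|` l| = ar E &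
   forall Z : {fset nat}, (forall z, z \in Z -> (size ps <= z)%N) ->
     \sum_E alpha E * (weight c (size ps) E Z)%:R <= (#|` Z|)%:R].

(** Codes that are not [good] contribute no hyperedges, so the type of terms needs no side
    condition. *)
Definition new_edge c ps E (S : {fset term}) :=
  exists l, [/\ good c ps, (E, l) \in c, ~~ (l `<=` below (size ps)) & S = el c ps @` l].

Definition term_edge E (S : {fset term}) : bool :=
  `[< (exists2 S0, e E S0 & S = Base @` S0) \/ exists c ps, new_edge c ps E S >].

Lemma new_edge_new c ps E S : new_edge c ps E S ->
  exists2 i, (size ps <= i)%N & New c ps i \in S.
Proof.
case=> l [_ _ nl ->]; have [i il ni] : exists2 i, i \in l & (size ps <= i)%N.
  have [//|no] := pselect (exists2 i, i \in l & (size ps <= i)%N).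
  case/negP: nl; apply/fsubsetP => i il; rewrite mem_below ltnNge.
  by apply/negP => ni; apply: no; exists i.
exists i => //; apply/imfsetP; exists i => //.
by rewrite /el ltnNge ni.
Qed.

(** At a vertex of maximal height the second case is impossible, so a new hyperedge through it
    belongs to its own adjunction. *)
Lemma new_edge_mem c ps E S c' ps' k : new_edge c ps E S -> New c' ps' k \in S ->
  c' = c /\ ps' = ps \/
  exists i, New c ps i \in S /\ (height (New c' ps' k) < height (New c ps i))%N.
Proof.
move=> ne; have [i ni iS] := new_edge_new ne.
have [l [_ _ _ SE]] := ne.
rewrite {1}SE => /imfsetP[j /= jl]; rewrite /el.
case: ltnP => [jps kE|_ [-> -> _]]; last by left.
by right; exists i; split; [|rewrite kE; apply: height_param; apply: mem_nth].
Qed.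

Lemma Base_inj : injective (Base : T -> term). Proof. by move=> ? ? []. Qed.

Lemma term_edge_Base E (S : {fset T}) : term_edge E (Base @` S) = e E S.
Proof.
apply/asboolP/idP => [[[S0 eS0 ES]|[c [ps /new_edge_new[i _ /imfsetP[]//]]]]|eS].
  suff -> : S = S0 by [].
  apply/fsetP => x; have /fsetP/(_ (Base x)) := ES.
  by rewrite !mem_imfset //; apply: Base_inj.
by left; exists S.
Qed.

Lemma term_edge_uniform : uniform ar term_edge.
Proof.
move=> E S /asboolP[[S0 /uni <- ->]|[c [ps [l [[ups cl _] /cl <- _ ->]]]]].
  by rewrite card_imfset //; apply: Base_inj.
by rewrite card_imfset //; apply: el_inj.
Qed.

Lemma dl_le_rel (U : choiceType) (f : L -> {fset U} -> bool) (X' X : {fset U}) (w : L -> nat) :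
  X' `<=` X -> (forall E, (cnt f E X <= cnt f E X' + w E)%N) ->
  \sum_E alpha E * (w E)%:R <= (#|` X `\` X'|)%:R -> dl alpha f X' <= dl alpha f X.
Proof.
move=> X'X lew; rewrite (cardfsDS X'X) natrB ?fsubset_leq_card // => sumw.
have : \sum_E alpha E * (cnt f E X)%:R <=
    \sum_E alpha E * (cnt f E X')%:R + \sum_E alpha E * (w E)%:R.
  rewrite -big_split /=; apply: ler_sum => E _; rewrite -mulrDr -natrD.
  by rewrite ler_wpM2l ?ler_nat // (alpha_ge0 halpha).
by rewrite /dl; lra.
Qed.

(* All hyperedges through the new points of an adjunction of maximal height come from
   that adjunction, so removing these points does not increase the predimension. *)
Lemma term_dl_ge0 (X : {fset term}) : 0 <= dl alpha term_edge X.
Proof.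
have [n] := ubnP #|` X|; elim: n X => // n IH X; rewrite ltnS => cX.
have [->|[x0 x0X]] := fset_0Vmem X.
  rewrite dl0 // => E; apply/negP => /term_edge_uniform/eqP.
  by rewrite cardfs0; have := har E; case: (ar E).
have [x xX xmax] : exists2 x, x \in X & forall y, y \in X -> (height y <= height x)%N.
  have [[x xX] _ xmax] := arg_maxnP (fun x : X => height (val x)) (isT : predT [` x0X]).
  by exists x => // y yX; apply: (xmax [` yX]).
case Ex: x => [t|c ps k].
  pose unbase (y : term) := if y is Base t then Some t else None.
  have XE : X = Base @` [fset t in pmap unbase (enum_fset X)].
    apply/fsetP => y; apply/idP/imfsetP => /= [yX|[t']].
      have := xmax y yX; rewrite Ex; case: y yX => //= t' t'X _; exists t' => //.
      by rewrite inE /= mem_pmap; apply/mapP; exists (Base t').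
    by rewrite inE /= mem_pmap => /mapP[[t''|//] yX [->]] ->.
  rewrite XE (_ : dl _ _ _ = dl alpha e [fset t in pmap unbase (enum_fset X)]) //.
  by apply: dl_transport => [? ? _ _|E S _]; [apply: Base_inj|apply: term_edge_Base].
pose inV (y : term) := if y is New c' ps' _ then (c' == c) && (ps' == ps) else false.
pose X' := [fset y in X | ~~ inV y].
have X'X : X' `<=` X by apply: fset_sub.
have ge0X' : 0 <= dl alpha term_edge X'.
  apply: IH; apply: leq_trans cX; apply: fproper_ltn_card; rewrite fproperEneq X'X andbT.
  by apply/eqP => /fsetP/(_ x); rewrite !inE xX Ex /= !eqxx.
apply: le_trans ge0X' _.
have in_new E S y : term_edge E S -> S `<=` X -> y \in S -> inV y -> new_edge c ps E S.
  move=> /asboolP[[S0 _ ->] _ /imfsetP[t _ ->] //|[c' [ps' ne]] /fsubsetP SX].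
  case: y => // c'' ps'' k'' yS /andP[/eqP Ec /eqP Ep]; rewrite Ec Ep in yS.
  have [[-> ->] //|[i [iS]]] := new_edge_mem ne yS.
  have := xmax _ (SX _ iS); rewrite Ex; move=> le lt.
  by have := leq_trans lt le; rewrite /= ltnn.
pose n0 := size ps.
pose idx (y : term) : nat := if y is New _ _ i then i else 0%N.
pose Z : {fset nat} := [fset i in [seq idx y | y <- enum_fset X & inV y] | (n0 <= i)%N].
have memZ i : (n0 <= i)%N -> New c ps i \in X -> i \in Z.
  move=> ni iX; rewrite !inE ni andbT; apply/mapP; exists (New c ps i) => //.
  by rewrite mem_filter /= !eqxx.
have leU (F : {fset {fset term}}) E : (forall S, term_edge E S -> S `<=` X ->
    (exists2 y, y \in S & inV y) -> S \in F) ->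
    (cnt term_edge E X <= cnt term_edge E X' + #|` F|)%N.
  move=> inF; apply: leq_trans (leq_card_fsetU _ _); apply: fsubset_leq_card.
  apply/fsubsetP => S; rewrite !inE /= !fpowersetE => /andP[SX eS]; rewrite eS andbT.
  have [mt|no] := pselect (exists2 y, y \in S & inV y); first by rewrite inF ?orbT.
  apply/orP; left; apply/fsubsetP => y yS; rewrite !inE (fsubsetP SX) //=.
  by apply/negP => yV; apply: no; exists y.
have [gd|ngd] := pselect (good c ps); last first.
  apply: (dl_le_rel (w := fun _ => 0%N)) => //; last first.
    by rewrite big1 // => E _; rewrite mulr0.
  move=> E; have := leU fset0 E; rewrite cardfs0; apply=> S eS SX [y yS yV].
  by have [l [gd]] := in_new _ _ _ eS SX yS yV.
have [_ _ sumw] := gd.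
apply: (dl_le_rel (w := fun E => weight c n0 E Z)) => //.
  move=> E; pose F := [fset l in fpowerset (below n0 `|` Z) | ((E, l) \in c) && ~~ (l `<=` below n0)].
  apply: (@leq_trans (cnt term_edge E X' + #|` (fun l : {fset nat} => el c ps @` l) @` F|)); last first.
    by rewrite leq_add2l; apply: leq_card_image.
  apply: leU => S eS SX [y yS yV]; have [l [_ lc nl SE]] := in_new _ _ _ eS SX yS yV.
  apply/imfsetP; exists l => //=; rewrite !inE /= lc nl fpowersetE !andbT.
  apply/fsubsetP => i il; rewrite inE mem_below.
  case: ltnP => //= ni; apply: memZ => //; apply: (fsubsetP SX); rewrite SE.
  by apply/imfsetP; exists i => //; rewrite /el ltnNge ni.
apply: le_trans (sumw Z _) _; first by move=> i; rewrite !inE => /andP[].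
rewrite ler_nat; apply: leq_trans (leq_card_image idx (X `\` X')).
apply: fsubset_leq_card; apply/fsubsetP => i; rewrite !inE => /andP[/mapP[y + ->] _].
rewrite mem_filter => /andP[yV yX]; apply: in_imfset; rewrite /= !inE.
by rewrite -[y \in X]/(y \in enum_fset X) yX yV.
Qed.

Definition term_model : lstruct ar := hg_struct ar term_edge.

Lemma term_model_edge E S : @edge L ar term_model E S = term_edge E S.
Proof. exact/edge_hg/term_edge_uniform. Qed.

(** For a strong extension [Y] of [X] and an embedding of [X], the code [c] lists the hyperedges not
    inside [X] and [ps] lists the images of [X]. Strength makes the code [good], and the points
    [New c ps i] realise the rest of [Y]. *)
Lemma term_model_is_model : T -> is_model alpha term_model.
Proof.
move=> t0; have dlE (X : {fset term_model}) : delta alpha X = dl alpha term_edge X.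
  by rewrite delta_dl; apply: hg_dl; apply: term_edge_uniform.
split=> [A|B X Y [KY Y0] [XY strong] f embf].
  by split; [exact: hg_inKL|move=> A' _; rewrite dlE term_dl_ge0].
have KX : inKL X.
  move=> E t t'; pose lift (x : X) : Y := [` fsubsetP XY _ (valP x)].
  have liftE (u : (ar E).-tuple X) : map_tuple val (map_tuple lift u) = map_tuple val u.
    by apply: eq_from_tnth => i; rewrite !tnth_map.
  have [h1 h2] := KY E (map_tuple lift t) (map_tuple lift t').
  rewrite -!liftE; split=> [/h1|tt']; last by apply: h2; apply: perm_map.
  by rewrite /= map_inj_uniq // => x y /(congr1 val) /= /val_inj.
have [F [isoF Ff]] := iso_of_emb (Base t0 : term_model) embf.
(* The points of [X] come first, so that indices below [n] are those of parameters. *)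
pose sq := enum_fset X ++ enum_fset (Y `\` X).
have usq : uniq sq.
  rewrite cat_uniq !fset_uniq /= andbT; apply/hasPn => b.
  by rewrite -[_ \in enum_fset _]/(b \in Y `\` X) inE => /andP[].
have memsq b : b \in sq = (b \in Y).
  rewrite mem_cat -[_ \in enum_fset X]/(b \in X) -[_ \in enum_fset _]/(b \in Y `\` X) inE.
  by case bX: (b \in X) => //=; rewrite (fsubsetP XY).
pose idx b := index b sq.
have idx_inj : {in Y &, injective idx}.
  move=> b b' bY b'Y E; rewrite -(nth_index b (s := sq) (x := b)) ?memsq //.
  by rewrite -[index b sq]/(idx b) E nth_index // memsq.
pose n := #|` X|.
have idxX b : b \in Y -> (idx b < n)%N = (b \in X).
  move=> bY; rewrite /idx index_cat -[_ \in enum_fset X]/(b \in X).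
  by case: ifP => bX; [rewrite index_mem | apply/negbTE; rewrite -leqNgt leq_addr].
pose pairs : seq (L * {fset B}) := [seq p <- [seq (E, A) | E <- enum L, A <- enum_fset (fpowerset Y)]
                | edge p.1 p.2 && ~~ (p.2 `<=` X)].
pose c : code := [seq (p.1, idx @` p.2) | p : L * {fset B} <- pairs].
have cP E l : reflect (exists S, [/\ S `<=` Y, edge E S, ~~ (S `<=` X) & l = idx @` S])
    ((E, l) \in c).
  apply: (iffP idP) => [/mapP[[E' S]]|[S [SY eS nS ->]]].
    rewrite mem_filter => /andP[/= /andP[eS nS] /allpairsP[[E'' S'] /= [_ S'Y [EE ES]]]] [-> ->].
    exists S; split=> //; rewrite -fpowersetE ES; exact: S'Y.
  apply/mapP; exists (E, S) => //; rewrite mem_filter /= eS nS /=; apply/allpairsP; exists (E, S).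
  by split=> //=; [rewrite mem_enum|move: SY; rewrite -fpowersetE].
pose ps := map F (enum_fset X).
have szps : size ps = n by rewrite size_map.
have ups : uniq ps by rewrite map_inj_in_uniq ?fset_uniq //; exact: isoF.1.
have subX S : S `<=` Y -> (idx @` S `<=` below n) = (S `<=` X).
  move=> SY; apply/fsubsetP/fsubsetP => sub b.
    move=> bS; rewrite -idxX ?(fsubsetP SY) // -mem_below.
    by apply: sub; apply: in_imfset.
  by case/imfsetP => b' /= b'S ->; rewrite mem_below idxX ?(fsubsetP SY) // sub.
have gd : good c ps.
  split=> //.
    move=> E l /cP[S [SY eS _ ->]]; rewrite card_in_imfset /=; first exact: edge_card KY SY eS.
    by move=> b b' /(fsubsetP SY) bY /(fsubsetP SY); apply: idx_inj.
  (* [Y'] is the subextension of [Y] with new indices in [Z]; strength of [X] in [Y'] is the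
     required bound on the weight. *)
  rewrite szps => Z nZ; pose Y' := [fset b in Y | (b \in X) || (idx b \in Z)].
  have XY' : X `<=` Y' by apply/fsubsetP => b bX; rewrite !inE bX (fsubsetP XY).
  have Y'Y : Y' `<=` Y by apply: fset_sub.
  have := strong Y' XY' Y'Y; rewrite !delta_dl => leXY'.
  have cntW E : (weight c n E Z <= cnt (@edge L ar B) E Y' - cnt (@edge L ar B) E X)%N.
    pose FX := [fset S in fpowerset X | edge E S].
    pose FY := [fset S in fpowerset Y' | edge E S].
    have FXY : FX `<=` FY.
      apply/fsubsetP => S; rewrite !inE /= !fpowersetE => /andP[SX ->].
      by rewrite (fsubset_trans SX).
    rewrite -(cardfsDS FXY).
    apply: leq_trans (leq_card_image (fun S : {fset B} => idx @` S) (FY `\` FX)).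
    apply: fsubset_leq_card; apply/fsubsetP => l; rewrite !inE /= fpowersetE.
    move=> /andP[/fsubsetP lZ /andP[/cP[S [SY eS nS lE]] _]].
    rewrite lE; apply: in_imfset; rewrite /= !inE /= !fpowersetE eS !andbT nS /=.
    apply/fsubsetP => b bS; have bY := fsubsetP SY b bS; rewrite !inE bY /=.
    have : idx b \in l by rewrite lE; apply: in_imfset.
    by move=> /lZ; rewrite inE mem_below idxX.
  apply: (@le_trans _ _ (\sum_E alpha E * (cnt (@edge L ar B) E Y' - cnt (@edge L ar B) E X)%:R)).
    by apply: ler_sum => E _; rewrite ler_wpM2l ?ler_nat ?(alpha_ge0 halpha).
  apply: (@le_trans _ _ (#|` Y' `\` X|)%:R); last first.
    have <- : #|` idx @` (Y' `\` X)| = #|` Y' `\` X|; last rewrite ler_nat.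
      rewrite card_in_imfset // => b b' /= /fsetDP[/(fsubsetP Y'Y) bY _] /fsetDP[/(fsubsetP Y'Y) b'Y _]; exact: idx_inj.
    apply: fsubset_leq_card; apply/fsubsetP => _ /imfsetP[b /= /fsetDP[bY' bX] ->].
    by move: bY'; rewrite !inE (negPf bX) => /andP[].
  rewrite (cardfsDS XY') natrB ?fsubset_leq_card //.
  under eq_bigr do rewrite natrB ?cnt_mono // mulrBr.
  by rewrite sumrB; move: leXY'; rewrite /dl; lra.
pose g b : term_model := el c ps (idx b).
have gX b : b \in X -> g b = F b.
  move=> bX; have ib := idxX b (fsubsetP XY _ bX); rewrite bX in ib.
  rewrite /g /el szps ib (nth_map b); last by rewrite -[size _]/n.
  by rewrite /idx index_cat -[_ \in enum_fset X]/(b \in X) bX nth_index.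
have gN b : b \in Y -> b \notin X -> g b = New c ps (idx b).
  by move=> bY bX; rewrite /g /el szps idxX // (negPf bX).
have FY b k : b \in X -> (height (F b) < height (New c ps k))%N.
  by move=> bX; apply: height_param; apply: map_f.
have isog : iso_on g Y.
  apply: iso_of_edge => //; first exact: hg_inKL.
    by move=> b b' bY b'Y /(el_inj ups)/idx_inj; apply.
  move=> E S SY; have [SX|nS] := boolP (S `<=` X).
    rewrite -(iso_edge E isoF SX); congr (edge E _); apply: eq_imfset_in => b bS.
    by rewrite gX // (fsubsetP SX).
  have gS : g @` S = el c ps @` (idx @` S) by rewrite -imfset_comp.
  rewrite term_model_edge; apply/idP/idP => [/asboolP[[S0 _ E0]|[c' [ps' ne]]]|eS]; last first.
  - apply/asboolP; right; exists c, ps, (idx @` S); split=> //; last by rewrite szps subX.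
    by apply/cP; exists S.
  - have [y yS yX] : exists2 y, y \in S & y \notin X.
      by move: nS; rewrite -fsetD_eq0 => /fset0Pn[y /fsetDP[]]; exists y.
    have gy : New c ps (idx y) \in g @` S.
      by rewrite -gN ?(fsubsetP SY) //; apply: in_imfset.
    have [i _ iS] := new_edge_new ne.
    have [b bS gb] : exists2 b, b \in S & New c' ps' i = g b.
      by case/imfsetP: iS => b /=; exists b.
    have bY := fsubsetP SY _ bS.
    (* If [b] is outside [X], the hyperedge belongs to the adjunction [c], [ps]. If [b] is in [X],
       its image is a parameter, of height below that of the new point [y], whereas [new_edge_mem]
       at [y] gives an incompatible comparison. *)
    have [bX|bX] := boolP (b \in X); last first.
      move: gb; rewrite gN // => -[cE pE _].
      case: ne => l [_]; rewrite cE pE => /cP[S' [S'Y eS' _ ->]] _ EgS.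
      suff -> : S = S' by [].
      have sub (S1 S2 : {fset B}) : S1 `<=` Y -> S2 `<=` Y ->
          el c ps @` (idx @` S1) = el c ps @` (idx @` S2) -> S1 `<=` S2.
        move=> S1Y S2Y E12; apply/fsubsetP => z zS1.
        have : el c ps (idx z) \in el c ps @` (idx @` S2).
          by rewrite -E12; do 2!apply: in_imfset.
        case/imfsetP => _ /imfsetP[z' /= z'S2 ->] /(el_inj ups)/idx_inj -> //.
          exact: (fsubsetP S1Y).
        exact: (fsubsetP S2Y).
      by apply/eqP; rewrite eqEfsubset; apply/andP; split; apply: sub; rewrite // -?gS // EgS.
    have lt k : (height (New c' ps' i) < height (New c ps k))%N by rewrite gb gX // FY.
    have [[cE pE]|[j [_ ltj]]] := new_edge_mem ne gy.
      by have := lt i; rewrite cE pE ltnn.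
    by have := ltn_trans (lt (idx y)) ltj; rewrite ltnn.
  - have [y yS yX] : exists2 y, y \in S & y \notin X.
      by move: nS; rewrite -fsetD_eq0 => /fset0Pn[y /fsetDP[]]; exists y.
    have : g y \in g @` S by apply: in_imfset.
    by rewrite gN ?(fsubsetP SY) // E0 => /imfsetP[].
exists (fun y : Y => g (val y)); split; first exact: emb_of_iso.
by move=> x y xy; rewrite -xy gX ?Ff //; apply: valP.
Qed.

End TermModel.

(** * The equivalence *)

Section Equivalence.
Variables (R : realType) (L : finType) (ar : L -> nat) (alpha : L -> R).
Hypothesis har : forall E, (2 <= ar E)%N.
Hypothesis halpha : forall E, 0 < alpha E <= 1.
Local Notation dm := (dl alpha (@edge L ar _)).

Lemma iso_id (M : lstruct ar) (X : {fset M}) : iso_on id X.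
Proof.
split=> [x y _ _ //|E t _]; congr (lrel E _).
by apply: eq_from_tnth => i; rewrite tnth_map.
Qed.

Lemma iso_on0 (M N : lstruct ar) (h : M -> N) : iso_on h fset0.
Proof.
split=> [x y|E t tX]; first by rewrite inE.
have := tX _ (mem_tnth (Ordinal (leq_trans (isT : (0 < 2)%N) (har E))) t).
by rewrite inE.
Qed.

Lemma dl_fset0 (T : choiceType) (e : L -> {fset T} -> bool) : uniform ar e -> dl alpha e fset0 = 0.
Proof.
move=> unie; apply: dl0 => E; apply/negP => /unie/eqP.
by rewrite cardfs0; have := har E; case: (ar E).
Qed.

Lemma sat_qfree_iso (M N : lstruct ar) (h : M -> N) (C : {fset M}) (phi : formula ar) u u' :
  qfree phi -> iso_on h C -> (forall x, Defs.free x phi -> u x \in C /\ u' x = h (u x)) ->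
  sat u phi <-> sat u' phi.
Proof.
move=> + iso; elim: phi => //= [x y|E t|p IH|p IHp q IHq].
- move=> _ fv; have [|xC ->] := fv x; first by rewrite eqxx.
  have [|yC ->] := fv y; first by rewrite eqxx orbT.
  by split=> [->//|]; apply: iso.1.
- move=> _ fv; have -> : map_tuple u' t = map_tuple h (map_tuple u t).
    by apply: eq_from_tnth => i; rewrite !tnth_map; have [|] := fv (tnth t i); rewrite ?mem_tnth.
  by rewrite iso.2 // => _ /mapP[x xt ->]; have [] := fv x.
- by move=> /IH{}IH fv; rewrite (IH fv).
move=> /andP[/IHp{}IHp /IHq{}IHq] fv.
by rewrite IHp ?IHq // => x fx; apply: fv; rewrite fx ?orbT.
Qed.

Variable M : lstruct ar.
Hypothesis hM : is_model alpha M.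
Local Notation edgeM := (@edge L ar M).

Lemma edgeM_uniform : uniform ar edgeM.
Proof. by move=> E S; apply: (edge_card _ (fsubset_refl S)); apply: model_inKL hM. Qed.

Lemma leMP (A : {fset M}) : leM alpha A <-> forall B, A `<=` B -> dm A <= dm B.
Proof.
split=> [clA B AB|clA B AB].
  by have [_ /(_ B AB (fsubset_refl B))] := clA B AB; rewrite !delta_dl.
by split=> // A' AA' _; rewrite !delta_dl clA.
Qed.

Lemma zero_leM (B : {fset M}) : delta alpha B = 0 -> leM alpha B.
Proof. by rewrite delta_dl => dB; apply/leMP => B' _; rewrite dB model_ge0. Qed.

Definition zero_cofinal :=
  forall A : {fset M}, exists B : {fset M}, A `<=` B /\ delta alpha B = 0.

Lemma zero_cofinal_dM : zero_cofinal ->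
  (forall A : {fset M}, dM alpha A = 0%E) /\ fin_closures alpha M.
Proof.
move=> zero; split=> A; have [B [AB dB]] := zero A; last first.
  by exists B; split=> //; apply: zero_leM.
apply/eqP; rewrite eq_le; apply/andP; split.
  by apply: ereal_inf_lbound; exists B; [split=> //; apply: zero_leM|rewrite dB].
apply: le_ereal_inf_tmp => _ [B' _ <-].
by rewrite lee_fin delta_dl model_ge0.
Qed.

(** A closed [B] attains the infimum defining [dM] of [B], so its predimension is 0. *)
Lemma dM_zero_cofinal : (forall A : {fset M}, dM alpha A = 0%E) /\ fin_closures alpha M ->
  zero_cofinal.
Proof.
move=> [d0 fc] A; have [B [AB clB]] := fc A; exists B; split=> //.
have dB : 0 <= delta alpha B by rewrite delta_dl model_ge0.
apply/eqP; rewrite eq_le dB andbT.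
suff : ((delta alpha B)%:E <= dM alpha B)%E by rewrite d0 lee_fin.
apply: le_ereal_inf_tmp => _ [B' [BB' _] <-].
by rewrite lee_fin !delta_dl; apply: (proj1 (leMP B) clB).
Qed.

(** The image in [N] of a set of predimension 0 is strong in every finite set of [N]. The witnesses,
    together with this image, therefore embed back into [M] over the parameters. *)
Lemma zero_cofinal_ex_closed : zero_cofinal -> ex_closed alpha M /\ fin_closures alpha M.
Proof.
move=> zero; split; last by have [] := zero_cofinal_dM zero.
move=> N h hN [injh hrel] ys phi qf v /sat_exs[u [uv su]].
have [m fvm] := fv_bound phi.
have [x0 _] := model_inhabited har hM.
have [B [AB dB]] := zero [fset v x | x in iota 0 m].
have isoh : iso_on h B by split=> [x y _ _ /injh//|E t _].
have [h' [isoh' _ h'h]] := iso_inv x0 isoh.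
rewrite delta_dl in dB.
pose C := h @` B `|` [fset u x | x in iota 0 m].
have [g [isog gh']] : exists g, iso_on g C /\ {in h @` B, g =1 h'}.
  apply: (model_extend hM x0) => //.
  - exact: model_inKL hN.
  - by move=> A _; apply: model_ge0 hN.
  - exact: fsubsetUl.
  by move=> A' _ _; rewrite (iso_dl _ isoh) // dB model_ge0.
apply/sat_exs; exists (fun x => if x \in ys then g (u x) else v x); split.
  by move=> x /negPf ->.
apply: (proj1 (sat_qfree_iso qf isog _) su) => x /fvm xm.
have xi : x \in iota 0 m by rewrite mem_iota.
split; first by rewrite inE; apply/orP; right; apply: in_imfset.
case: ifP => // /negbT xys.
have vB : v x \in B by apply: (fsubsetP AB); apply: in_imfset.
by rewrite uv //= gh' ?h'h //; apply: in_imfset.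
Qed.

Hypothesis hnot : ~ (forall E : L, ar E = 2%N /\ alpha E = 1).

(** The type is isolated by the formula saying that the parameters lie in a copy of [B]: every such
    copy has predimension 0, hence is [k]-closed for all [k], and [back_and_forth] applies. *)
Lemma zero_cofinal_atomic : zero_cofinal -> atomic M.
Proof.
move=> zero n v; have [B [AB dB]] := zero (v 0%N |` [fset v x | x in iota 0 n]).
have vB i : (i < n)%N -> v i \in B.
  move=> ni; apply: (fsubsetP AB); rewrite inE; apply/orP; right.
  by apply: in_imfset; rewrite mem_iota.
have B0 : (0 < #|` B|)%N.
  rewrite cardfs_gt0; apply/fset0Pn; exists (v 0%N); apply: (fsubsetP AB).
  by rewrite !inE eqxx.
have [ys [phi [_ fvphi satphi]]] := fset_diag B0 vB.
exists (exs ys phi); split=> //; split; first by apply/satphi; exists id; split=> //; apply: iso_id.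
move=> psi fvpsi spsi w /satphi[h [isoh hv]].
have [k bf] := back_and_forth har halpha hnot hM psi.
rewrite delta_dl in dB.
apply: (proj1 (bf B h v w isoh _ _ _) spsi).
- by move=> Y _ _; rewrite dB model_ge0.
- by move=> Y _ _; rewrite (iso_dl _ isoh) // dB model_ge0.
by move=> x /fvpsi xn; rewrite hv //; split=> //; apply: vB.
Qed.

(** This is [small_extension] over the empty base with [dm K] as the bound: the predimension falls
    below that of [K], but no [k] points suffice for it. *)
Lemma smaller_extension k (K : {fset M}) : 0 < dm K ->
  exists (e : L -> {fset M + nat} -> bool) Y,
  [/\ uniform ar e, supported e Y, inl @` K `<=` Y,
    (forall x, x \in Y -> x \notin (inl @` K : {fset M + nat}) -> is_inr x) &
  [/\ forall E S, S `<=` inl @` K -> e E S = inl_edges (mem K) E S,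
    dl alpha e Y < dm K, (forall X, X `<=` Y -> 0 <= dl alpha e X) &
    forall X, inl @` K `<=` X -> X `<=` Y -> (#|` X `\` inl @` K| <= k)%N ->
      dm K <= dl alpha e X]].
Proof.
move=> dK; have KM (X : {fset M}) : inKL X by apply: model_inKL hM.
have [m ext] := small_extension har halpha (@inr_infinite L ar M) hnot k #|` K| dK.
pose e0 := inl_edges (mem K).
have uni0 : uniform ar e0 by apply: inl_edges_uniform.
have dle0 (X : {fset M}) : X `<=` K -> dl alpha e0 (inl @` X) = dm X.
  by move=> /fsubsetP XK; apply: dl_inl_edges.
have [||||||e [Y [uni sup KY freY [agr _ smallY strongY closeY]]]] :=
  ext e0 fset0 (inl @` K).
- by [].
- exact: inl_edges_supported.
- exact: fsub0set.
- by rewrite card_inl.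
- by rewrite dl_fset0.
- move=> X _ /inl_preimage[A AK ->]; rewrite dl_fset0 // dle0 //.
  exact: model_ge0.
rewrite dl_fset0 // add0r in smallY strongY.
rewrite dle0 ?fsubset_refl // in closeY.
exists e, Y; split=> //; split=> // X XY.
by apply: strongY; rewrite ?fsub0set.
Qed.

(** If [B] is closed with positive predimension, an extension [Y] of smaller predimension is freely
    attached to [M] over [B], and the result is embedded in a model [N]. The existential formula
    placing [B] in a copy of [Y] descends to [M], against closedness of [B]. *)
Lemma ex_closed_zero_cofinal : ex_closed alpha M /\ fin_closures alpha M -> zero_cofinal.
Proof.
move=> [ec fc] A; have [B [AB /leMP clB]] := fc A; exists B; split=> //.
rewrite delta_dl; apply/eqP; apply: contraT => dB0.
have dB : 0 < dm B by rewrite lt_neqAle eq_sym dB0 model_ge0.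
have KM (X : {fset M}) : inKL X by apply: model_inKL hM.
have [x0 _] := model_inhabited har hM.
have [e1 [Y [uni1 sup1 BY freY [agr smallY ge1 _]]]] := smaller_extension 0 dB.
pose T := (M + nat)%type.
pose e2 := amalg e1 (predT : pred M).
have uni2 : uniform ar e2 by apply: amalg_uniform.
have ge2 X : 0 <= dl alpha e2 X.
  pose unl (z : T) := if z is inl x then Some x else None.
  pose A' : {fset M} := [fset x in pmap unl (enum_fset X)].
  have memA' x : (x \in A') = (inl x \in X).
    rewrite inE /= mem_pmap; apply/mapP/idP => [[[y|//] yX [->]]//|xX].
    by exists (inl x).
  (* Points of [X] outside [M] and [Y] lie in no hyperedge, so dropping them does not raise the
     predimension. On the rest, closedness of [B] bounds the predimension of the trace of [A'] on
     [B] by that of [A']. *)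
  pose X1 := inl @` A' `|` (X `&` Y).
  have X1X : X1 `<=` X.
    rewrite fsubUset fsubsetIl andbT; apply/fsubsetP => _ /imfsetP[x /= xA' ->].
    by rewrite -memA'.
  apply: (@le_trans _ _ (dl alpha e2 X1)); last first.
    apply: (dl_le_rel halpha (w := fun _ => 0%N)) => //; last first.
      by rewrite big1 // => E _; rewrite mulr0.
    move=> E; rewrite addn0; apply: fsubset_leq_card; apply/fsubsetP => S.
    rewrite !inE /= !fpowersetE => /andP[/fsubsetP SX eS]; rewrite eS andbT.
    apply/fsubsetP => z zS; rewrite /X1 !inE SX //=.
    case/orP: eS => [/asboolP[S0 [SE _ _]]|/sup1/fsubsetP/(_ z zS)->]; last by rewrite orbT.
    move: (zS); rewrite SE => /imfsetP[x /= xS0 zE]; apply/orP; left.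
    by rewrite zE mem_inl memA' -zE SX.
  have E : dl alpha e2 X1 + dm (A' `&` B) = dm A' + dl alpha e1 (X `&` Y).
    apply: (dl_amalg alpha sup1 BY freY agr) => //; first exact: fsubsetIr.
    by move=> x _ xB; rewrite memA' inE (mem_inlY BY freY) xB andbT.
  have := ge1 (X `&` Y) (fsubsetIr _ _).
  have := dlUI halpha edgeM A' B; have := clB (A' `|` B) (fsubsetUr _ _).
  by lra.
pose N := term_model ar alpha e2.
have hN : is_model alpha N by apply: term_model_is_model => //; exact: (inr 0%N : T).
pose h (x : M) : N := Base (inl x).
have hS (S : {fset M}) : h @` S = Base @` (inl @` S : {fset T}) by rewrite -imfset_comp.
have injh : injective h by move=> x y [].
have emb : embedding h.
  split=> // E t; have [] : iso_on h [fset x in tval t].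
    apply: iso_of_edge => //; first exact: hg_inKL.
      by move=> x y _ _; apply: injh.
    move=> E' S _; rewrite hS term_model_edge // term_edge_Base //.
    exact: (amalg_inl sup1 BY freY agr).
  by move=> _ /(_ E t) -> // x xt; rewrite inE.
have dlN (Z : {fset T}) : dm (Base @` Z : {fset N}) = dl alpha e2 Z.
  transitivity (dl alpha (term_edge ar alpha e2) (Base @` Z)).
    by apply: eq_dl => E S _; apply: term_model_edge.
  by apply: dl_transport => [? ? _ _|E S _]; [apply: Base_inj|apply: term_edge_Base].
have dlY : dm (Base @` Y : {fset N}) = dl alpha e1 Y.
  by rewrite dlN; apply: eq_dl => E S SY; apply: (amalg_Y _ BY freY agr).
pose v i := nth x0 (enum_fset B) i.
have vB i : (i < #|` B|)%N -> v i \in B by move=> iB; apply: mem_nth.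
have hvD i : (i < #|` B|)%N -> (h \o v) i \in (Base @` Y : {fset N}).
  move=> iB; apply: in_imfset; apply: (fsubsetP BY).
  by rewrite mem_inl vB.
have D0 : (0 < #|` (Base @` Y : {fset N})|)%N.
  rewrite cardfs_gt0; apply/fset0Pn; exists ((h \o v) 0%N); apply: hvD.
  rewrite cardfs_gt0; apply/eqP => B0; move: dB.
  by rewrite B0 dl_fset0 ?ltxx //; apply: edgeM_uniform.
have [ys [phi [qf _ satphi]]] := fset_diag D0 hvD.
have /(ec N h hN emb ys phi qf v)/satphi[g [isog gv]] : sat (h \o v) (exs ys phi).
  by apply/satphi; exists id; split=> //; apply: iso_id.
have BD : B `<=` g @` (Base @` Y : {fset N}).
  apply/fsubsetP => b bB; have ib : (index b (enum_fset B) < #|` B|)%N by rewrite index_mem.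
  rewrite -[b](nth_index x0 bB) -/(v _) -gv //; apply: in_imfset; exact: hvD.
have := clB _ BD; rewrite (iso_dl _ isog) ?fsubset_refl // dlY.
by rewrite leNgt smallY.
Qed.

Lemma min_between (A C : {fset M}) : A `<=` C -> exists K, [/\ A `<=` K, K `<=` C &
  forall X, A `<=` X -> X `<=` C -> dm K <= dm X].
Proof.
move=> AC; have CC : C \in fpowerset C by rewrite fpowersetE.
have [|[K KC] /= AK Kmin] :=
  arg_minP (i0 := [` CC]) (P := fun X : fpowerset C => A `<=` val X) (fun X : fpowerset C => dm (val X)).
  by [].
exists K; split=> // [|X AX XC]; first by rewrite -fpowersetE.
have XP : X \in fpowerset C by rewrite fpowersetE.
exact: (Kmin [` XP]).
Qed.

Lemma copy_closed k (D : {fset M}) : exists g, iso_on g D /\ kclosed alpha edgeM k (g @` D).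
Proof.
have [k1 ext] := closed_extension har halpha hnot hM k #|` D|.
have d0 : dm (fset0 : {fset M}) = 0 by apply: dl_fset0 edgeM_uniform.
have [| |||g [isog _ clg]] := ext fset0 D id (iso_id _).
- by move=> Y _ _; rewrite imfset0 d0 model_ge0.
- by [].
- by move=> X _ _; rewrite fset0I d0 model_ge0.
- by move=> X _ _ _; rewrite fset0I d0 model_ge0.
by exists g.
Qed.

(** The formula [phi] holds at every [k]-closed copy of [K]. One copy is built inside a set of
    smaller predimension, the other is too closed to have such a set around it, and an existential
    formula tells them apart. *)
Lemma atomic_zero_cofinal : atomic M -> zero_cofinal.
Proof.
move=> at_M A; have [x0 _] := model_inhabited har hM.
pose n := #|` A|; pose v i := nth x0 (enum_fset A) i.
have vA i : (i < n)%N -> v i \in A by move=> iA; apply: mem_nth.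
have Av a : a \in A -> exists2 i, (i < n)%N & a = v i.
  by move=> aA; exists (index a (enum_fset A)); rewrite ?index_mem // /v nth_index.
have [phi [fvphi [sphi iso_phi]]] := at_M n v.
have [k bf] := back_and_forth har halpha hnot hM phi.
have [s closure] := kclosure halpha k n.
have [C [AC clC _]] := closure _ edgeM A (fun X => model_ge0 X hM) (leqnn _).
(* Minimality over [A] inside the [k]-closed [C] makes [K] [k]-closed too; it is used again for the
   final contradiction. *)
have [K [AK KC Kmin]] := min_between AC.
have clK : kclosed alpha edgeM k K.
  move=> Y KY cY; have := dlUI halpha edgeM Y C.
  have := Kmin (Y `&` C) _ (fsubsetIr _ _).
  rewrite fsubsetI AC (fsubset_trans AK KY) => /(_ isT).
  have := clC (Y `|` C) (fsubsetUr _ _); rewrite fsetDUl fsetDv fsetU0 => /(_ _); move=> h.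
  have /h : (#|` Y `\` C| <= k)%N.
    by apply: leq_trans cY; apply: fsubset_leq_card; apply: fsetDS.
  lra.
exists K; split=> //; rewrite delta_dl; apply/eqP; apply: contraT => dK0.
have dK : 0 < dm K by rewrite lt_neqAle eq_sym dK0 model_ge0.
have KM (X : {fset M}) : inKL X by apply: model_inKL hM.
have d0 : dm (fset0 : {fset M}) = 0 by apply: dl_fset0 edgeM_uniform.
have [e1 [Y [uni1 sup1 KY freY [agr smallY ge1 closeY]]]] := smaller_extension k dK.
pose B := hg_struct ar e1.
have dlB (X : {fset B}) : dm X = dl alpha e1 X by apply: hg_dl.
have [G [isoG _]] : exists G : B -> M, iso_on G Y /\ {in (fset0 : {fset B}), G =1 fun _ => x0}.
  apply: (model_extend hM x0); first exact: hg_inKL.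
  - by move=> X XY; rewrite dlB ge1.
  - exact: fsub0set.
  - by move=> X _ XY; rewrite !dlB dl_fset0 // ge1.
  exact: iso_on0.
have iso_inl : iso_on (inl : M -> B) K.
  apply: iso_of_edge => //; first exact: hg_inKL.
    by move=> x y _ _; apply: inl_inj.
  move=> E S SK; rewrite edge_hg // agr ?inl_sub //.
  by rewrite inl_edgesE //; apply/fsubsetP.
pose D := G @` Y; pose h x := G (inl x).
have isoh : iso_on h K.
  by apply: (iso_comp iso_inl); apply: iso_sub isoG; exact: KY.
have hK : h @` K = G @` (inl @` K) by rewrite -imfset_comp.
have dmG (Z : {fset B}) : Z `<=` Y -> dm (G @` Z) = dl alpha e1 Z.
  by move=> ZY; rewrite (iso_dl _ isoG ZY) dlB.
have dD : dm D < dm K by rewrite dmG ?fsubset_refl.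
have hKD : h @` K `<=` D by rewrite hK; apply: imfset_sub.
have [g [isog clg]] := copy_closed k D.
have isogh : iso_on (g \o h) K by apply: iso_comp isoh (iso_sub hKD isog).
(* The image of [D] is [k]-closed, and no [k] points of [Y] lower the predimension of [K];
   submodularity combines the two. *)
have clgh : kclosed alpha edgeM k ((g \o h) @` K).
  move=> Y' ghY' cY'; rewrite (iso_dl _ isogh (fsubset_refl _)).
  pose Z : {fset B} := [fset z in Y | g (G z) \in Y'].
  have ZY : Z `<=` Y by apply: fset_sub.
  have gD : g @` D = (g \o G) @` Y by rewrite -imfset_comp.
  have isogG : iso_on (g \o G : B -> M) Y by apply: iso_comp isoG isog.
  have gZ : Y' `&` (g @` D) = (g \o G) @` Z.
    rewrite gD; apply/fsetP => y; rewrite inE.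
    apply/andP/imfsetP => /= [[yY' /imfsetP[z /= zY yE]]|[z]].
      by exists z; rewrite // !inE zY -yE.
    by rewrite !inE => /andP[zY zY'] ->; split=> //; apply/imfsetP; exists z.
  have KZ : inl @` K `<=` Z.
    apply/fsubsetP => z zK; rewrite !inE (fsubsetP KY) //=; apply: (fsubsetP ghY').
    by case/imfsetP: zK => x /= xK ->; apply/imfsetP; exists x.
  have leK : dm K <= dl alpha e1 Z.
    apply: closeY => //; apply: leq_trans cY'.
    have <- : #|` (g \o G) @` (Z `\` inl @` K)| = #|` Z `\` inl @` K|.
      rewrite card_in_imfset // => x y /= /fsetDP[/(fsubsetP ZY) xY _] /fsetDP[/(fsubsetP ZY) yY _].
      exact: isogG.1.
    apply: fsubset_leq_card; apply/fsubsetP => _ /imfsetP[z /= /fsetDP[zZ zK] ->].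
    move: (zZ); rewrite !inE => /andP[zY zY']; rewrite zY' andbT.
    apply: contra zK => /imfsetP[x /= xK E]; apply/imfsetP; exists x => //.
    by apply: isogG.1; rewrite // (fsubsetP KY) // mem_inl.
  have := dlUI halpha edgeM Y' (g @` D); rewrite gZ (iso_dl _ isogG ZY) dlB.
  have := clg (Y' `|` g @` D) (fsubsetUr _ _); rewrite fsetDUl fsetDv fsetU0 => h1.
  have /h1 : (#|` Y' `\` g @` D| <= k)%N.
    apply: leq_trans cY'; apply: fsubset_leq_card; apply: fsetDS.
    by rewrite imfset_comp; apply: imfset_sub.
  lra.
(* Closed even against as many points as [D] has, so that no copy of [D] can lower the
   predimension. *)
have [g1 [isog1 clg1]] := copy_closed (maxn k #|` D|) K.
have clg1k : kclosed alpha edgeM k (g1 @` K) by apply: kclosed_le clg1; apply: leq_maxl.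
have vK i : (i < n)%N -> v i \in K by move=> /vA/(fsubsetP AK).
have sw1 : sat (g1 \o v) phi.
  by apply: (proj1 (bf K g1 v _ isog1 clK clg1k _) sphi) => x /fvphi xn; split=> //; apply: vK.
have sw2 : sat ((g \o h) \o v) phi.
  by apply: (proj1 (bf K (g \o h) v _ isogh clK clgh _) sphi) => x /fvphi xn; split=> //; apply: vK.
have hvD i : (i < n)%N -> (h \o v) i \in D.
  by move=> /vK iK; apply: (fsubsetP hKD); apply: in_imfset.
have D0 : (0 < #|` D|)%N.
  have : (0 < #|` K|)%N.
    by rewrite cardfs_gt0; apply/eqP => K0; move: dK; rewrite K0 d0 ltxx.
  move=> /leq_trans; apply; rewrite -(_ : #|` h @` K| = #|` K|) ?fsubset_leq_card //.
  by rewrite card_in_imfset //; exact: isoh.1.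
have [ys [psi [_ fvpsi satpsi]]] := fset_diag D0 hvD.
have s2 : sat ((g \o h) \o v) (exs ys psi) by apply/satpsi; exists g.
(* Whichever of the formula and its negation holds at [v] is implied by [phi]; the copy inside the
   image of [D] excludes the negation, so the formula holds at the other copy as well. *)
have [/(iso_phi _ fvpsi)|ns] := pselect (sat v (exs ys psi)); last first.
  by case: (iso_phi (F_not (exs ys psi)) fvpsi ns _ sw2).
move=> /(_ _ sw1)/satpsi[f [isof fv]].
pose X := [fset x in K | g1 x \in f @` D].
have XK : X `<=` K by apply: fset_sub.
have AX : A `<=` X.
  apply/fsubsetP => a /Av[i iA ->]; rewrite !inE vK //=.
  by rewrite -[g1 _]/((g1 \o v) i) -fv //; apply: in_imfset; apply: hvD.
have XE : g1 @` K `&` f @` D = g1 @` X.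
  apply/fsetP => y; rewrite inE; apply/andP/imfsetP => /= [[/imfsetP[x /= xK ->] xD]|[x]].
    by exists x => //; rewrite !inE xK.
  by rewrite !inE => /andP[xK xD] ->; split=> //; apply: in_imfset.
(* The overlap [X] contains [A], so [dm X >= dm K] by minimality; the union then has predimension at
   most [dm D], which is below [dm K]. *)
have := dlUI halpha edgeM (g1 @` K) (f @` D); rewrite XE (iso_dl _ isog1 XK).
rewrite (iso_dl _ isof (fsubset_refl _)) (iso_dl _ isog1 (fsubset_refl _)).
have := Kmin X AX (fsubset_trans XK KC).
have := clg1 (g1 @` K `|` f @` D) (fsubsetUl _ _).
rewrite fsetDUl fsetDv fset0U (iso_dl _ isog1 (fsubset_refl _)) => h1.
have /h1 : (#|` f @` D `\` g1 @` K| <= maxn k #|` D|)%N.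
  rewrite leq_max; apply/orP; right; apply: leq_trans (leq_card_image f D).
  by apply: fsubset_leq_card; apply: fsubsetDl.
by move: dD; lra.
Qed.

End Equivalence.

Theorem theorem5p9 (R : realType) (L : finType) (ar : L -> nat) (alpha : L -> R)
  (har : forall E : L, (2 <= ar E)%N)
  (halpha : forall E : L, 0 < alpha E <= 1)
  (hnot : ~ (forall E : L, ar E = 2%N /\ alpha E = 1))
  (M : lstruct ar) (hM : is_model alpha M) :
  [<-> atomic M;
       (forall A : {fset M}, dM alpha A = 0%E) /\ fin_closures alpha M;
       ex_closed alpha M /\ fin_closures alpha M;
       forall A : {fset M}, exists B : {fset M}, A `<=` B /\ delta alpha B = 0].
Proof.
tfae.
- by move=> /(atomic_zero_cofinal har halpha hM hnot); apply: zero_cofinal_dM.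
- by move=> /(dM_zero_cofinal hM); apply: zero_cofinal_ex_closed.
- exact: ex_closed_zero_cofinal.
- exact: zero_cofinal_atomic.
Qed.
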